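(* Let $\Gamma \curvearrowright (X,\mu)$ be an ergodic measure preserving action of a discrete group $\Gamma$ on a $\sigma$-finite measure space $(X,\mu)$. Then the following are equivalent: (1) The action $\Gamma \curvearrowright (X,\mu)$ is strongly ergodic. (2) There exists a measurable subset $B \subset X$ with $0 < \mu(B) < +\infty$ such that the action $\Gamma \curvearrowright (X,\mu)$ has local spectral gap with respect to $B$.
   Context: Local spectral gap: let $\Gamma \curvearrowright (X,\mu)$ be an ergodic measure preserving action of a discrete group on a $\sigma$-finite measure space and let $B \subset X$ be measurable with $0<\mu(B)<+\infty$. The action has local spectral gap with respect to $B$ if there exist a finite set $S \subset \Gamma$ and a constant $\kappa>0$ such that $\|f\|_{2,B} \leq \kappa \sum_{g \in S} \|g\cdot f - f\|_{2,B}$ for every $f \in L^2(X,\mu)$ with $\int_B f \, d\mu = 0$. Here $\|f\|_{2,B} := \left(\int_B |f|^2 \, d\mu\right)^{1/2}$ and $(g\cdot f)(x) = f(g^{-1}x)$. Strong ergodicity: let $\nu$ be a probability measure on $X$ equivalent to $\mu$ (the notion does not depend on the choice of $\nu$). The action is strongly ergodic if for every net $(A_i)_{i\in I}$ of measurable subsets of $X$ such that $\lim_i \nu(gA_i \,\triangle\, A_i) = 0$ for all $g \in \Gamma$, one has $\lim_i \nu(A_i)(1-\nu(A_i)) = 0$. Equivalently, every norm-bounded net $(f_i)_{i \in I}$ in $L^\infty(X,\mu)$ with $\lim_i \|g\cdot f_i - f_i\|_{L^2(\nu)} = 0$ for all $g\in\Gamma$ satisfies $\lim_i \|f_i - \int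 f_i\, d\nu\|_{L^2(\nu)} = 0$. When $\Gamma$ is countable, nets may be replaced by sequences. *)

(* Defs.v *)
From HB Require Import structures.
From mathcomp Require Export all_boot all_order all_algebra finmap.
From mathcomp Require Export complex.
From mathcomp Require Export all_classical all_reals all_analysis.
Export numFieldNormedType.Exports.
Set Implicit Arguments.
Unset Strict Implicit.
Unset Printing Implicit Defensive.
Import Order.TTheory GRing.Theory Num.Theory.
Local Open Scope classical_set_scope.
Local Open Scope ring_scope.

Section Action.
Context {d : measure_display} {X : measurableType d} {R : realType}.
Context {G : groupType}.
Implicit Types (mu : {measure set X -> \bar R}) (act : G -> X -> X).

Definition measure_preserving_action mu act :=
  [/\ forall x, act 1%g x = x,
      forall g h x, act (g * h)%g x = act g (act h x),
      forall g, measurable_fun [set: X] (act g) &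
      forall g A, measurable A -> mu (act g @^-1` A) = mu A].

(* Invariance of A is modulo null sets, for each g separately.  For uncountable
   G this is strictly more demanding than ergodicity tested on the sets that
   are invariant on the nose. *)
Definition ergodic mu act :=
  forall A, measurable A ->
    (forall g, mu ((act g @` A) `+` A) = 0%E) ->
    mu A = 0%E \/ mu (~` A) = 0%E.

Definition translate act (g : G) (f : X -> R[i]) : X -> R[i] :=
  fun x => f (act g^-1%g x).

Definition square_integrable mu (f : X -> R[i]) :=
  [/\ measurable_fun [set: X] (fun x => complex.Re (f x)),
      measurable_fun [set: X] (fun x => complex.Im (f x)) &
      (\int[mu]_x (Normc.normc (f x) ^+ 2)%:E < +oo)%E].

(* [\int[mu]_(x in B) _] at type R is [fine] of the extended-real
   integral, with junk value 0 at infinity.  Both definitions below are only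
   applied to square integrable functions and sets B of finite measure, where
   all the integrals involved are finite. *)
Definition complex_integral mu (B : set X) (f : X -> R[i]) : R[i] :=
  Complex (\int[mu]_(x in B) complex.Re (f x))
          (\int[mu]_(x in B) complex.Im (f x)).

Definition local_norm2 mu (B : set X) (f : X -> R[i]) : R :=
  Num.sqrt (\int[mu]_(x in B) Normc.normc (f x) ^+ 2).

Definition local_spectral_gap mu act (B : set X) :=
  exists (S : {fset G}) (kappa : R), 0 < kappa /\
    forall f : X -> R[i], square_integrable mu f ->
      complex_integral mu B f = 0 ->
      local_norm2 mu B f <=
        kappa * \sum_(g <- S) local_norm2 mu B (fun x => translate act g f x - f x).

Definition directed_preorder (I : Type) (le : I -> I -> Prop) :=
  [/\ inhabited I,
      forall i, le i i,
      forall i j k, le i j -> le j k -> le i k &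
      forall i j, exists k, le i k /\ le j k].

(* The filter of eventual sets: for directed le, convergence of a net
   (u_i)_i along le is convergence along this filter. *)
Definition net_filter (I : Type) (le : I -> I -> Prop) : set_system I :=
  [set E | exists i, forall j, le i j -> E j].

Definition strongly_ergodic (nu : probability X R) act :=
  forall (I : Type) (le : I -> I -> Prop) (A : I -> set X),
    directed_preorder le ->
    (forall i, measurable (A i)) ->
    (forall g, nu ((act g @` A i) `+` A i) @[i --> net_filter le] --> 0%E) ->
    (nu (A i) * (1 - nu (A i)))%E @[i --> net_filter le] --> 0%E.

End Action.

(* Main.v *)
Require Import Defs.
From mathcomp Require Import ring lra measurable_realfun.

(** Both implications go through a quantitative form of strong ergodicity: for
    every e there are finitely many group elements and a delta such that a set
    moved by less than delta under each of them has nu-measure within e of 0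
    or 1, in the sense that nu A * (1 - nu A) < e ([strongly_ergodicP]; the
    net indexed by the pairs of a finite set and an integer gives the
    quantitative form from the statement about nets).

    A local spectral gap implies strong ergodicity.  Cut the indicator of an
    almost invariant set A down to B and to the finitely many translates of B
    seen by the gap, subtract the mean over B, and apply the gap inequality:
    A is either almost null or almost conull inside B
    ([local_gap_dichotomy]).  Almost invariance carries the same alternative
    to any translate of B, and by ergodicity finitely many translates of B
    cover X up to small measure ([ergodic_finite_cover]).

    Strong ergodicity implies a local spectral gap.  Choose X0 of finite
    mu-measure which, together with its relevant translates, is almost full
    for nu.  Regard the partial action of the finite set S on X0 as a graph,
    and let the boundary of C be the mu-measure of the edges inside X0 with
    exactly one endpoint in C.  If the boundary of C is at most e * mu C, with
    e small, then C is almost invariant, so its nu-measure is below 1/4 or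
    above 3/4.  Let C be maximal, up to null sets, among the sets of the first
    kind, and put B = X0 minus C ([exists_cheeger_set]).  A subset A of B of
    at most half its nu-measure whose boundary within B is less than e * mu A
    could be added to C: boundaries add up, the union has nu-measure at most
    3/4, hence less than 1/4, contrary to maximality.  So B satisfies a Cheeger
    inequality.  As in the proof of the Cheeger inequality for graphs,
    integrating it over the level sets of the squared positive and negative
    parts of u - c, for u the real or imaginary part of f and c a median of u,
    gives the gap in L^2 ([cheeger_local_spectral_gap]).  The set B cannot be
    arbitrary: for a finite measure, the gap may fail with B = X although the
    action is strongly ergodic. *)

Set Implicit Arguments.
Unset Strict Implicit.
Unset Printing Implicit Defensive.
Import Order.TTheory GRing.Theory Num.Theory.
Local Open Scope classical_set_scope.
Local Open Scope ring_scope.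

(** * Absolute continuity and exhaustion *)

Lemma null_dominates_small d (X : measurableType d) (R : realType)
    (m1 : {finite_measure set X -> \bar R}) (m2 : {measure set X -> \bar R}) :
  m1 `<< m2 -> forall e : R, 0 < e -> exists2 eta : R, 0 < eta &
    forall A, measurable A -> (m2 A < eta%:E)%E -> (m1 A < e%:E)%E.
Proof.
move=> m12 e e0.
have [P [N PN]] := Hahn_decomposition (charge_of_finite_measure m1).
have [eta [eta0 H]] := charge_variation_continuous PN m12 e0.
exists eta => // A mA mAeta; apply: le_lt_trans (H A mA mAeta).
have := abse_charge_variation PN mA.
by rewrite gee0_abs// measure_ge0.
Qed.

(** Greedy exhaustion: at step n enlarge the current set to within 1/(n+1) of
    the supremum of the measures of the admissible sets above it.  The union of
    the resulting chain cannot be enlarged by a non-null set. *)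
Lemma exhaustion d (X : measurableType d) (R : realType)
    (m : {finite_measure set X -> \bar R}) (P : set (set X)) (C0 : set X) :
  P `<=` measurable ->
  (forall F : (set X)^nat, (forall n, P (F n)) ->
    {homo F : n k / (n <= k)%N >-> n `<=` k} -> P (\bigcup_n F n)) ->
  P C0 ->
  exists C, P C /\ forall C', P C' -> C `<=` C' -> m (C' `\` C) = 0%E.
Proof.
move=> Pm PU PC0.
have mfin (A : set X) : measurable A -> m A \is a fin_num by exact: fin_num_measure.
have step (k : nat * {C | P C}) : exists C' : {C | P C},
    sval k.2 `<=` sval C' /\ forall D, P D -> sval C' `<=` D ->
      (m (D `\` sval C') < (k.1.+1%:R^-1)%:E)%E.
  case: k => k [C PC] /=.
  pose E := [set m C' | C' in [set C' | P C' /\ C `<=` C']].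
  have EC : E (m C) by exists C => //; split.
  have supE : ereal_sup E \is a fin_num.
    rewrite fin_real//; apply/andP; split.
      apply: lt_le_trans (ereal_sup_ubound EC).
      by rewrite (lt_le_trans _ (measure_ge0 _ _)).
    apply: (@le_lt_trans _ _ (m setT)); last by rewrite ltey_eq mfin.
    apply: ge_ereal_sup => _ [C' [PC' _] <-].
    by apply: le_measure; rewrite ?inE//; exact: Pm.
  have k0 : 0 < k.+1%:R^-1 :> R by [].
  have [_ [C' [PC' CC'] <-] ltC'] := ub_ereal_sup_adherent k0 supE.
  exists (exist _ C' PC') => /=; split => // D PD C'D.
  have /ereal_sup_ubound leD : E (m D).
    by exists D => //; split => //; exact: subset_trans C'D.
  rewrite -(lteD2rE _ _ (mfin _ (Pm _ PC'))).
  have -> : (m (D `\` C') + m C' = m D)%E.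
    by rewrite -{2}(setIidr C'D) -measureDI//; exact: Pm.
  rewrite addeC.
  by apply: (le_lt_trans leD); rewrite -lteBlDr.
have [f Hf] := choice step.
pose F := fix F n := if n is n'.+1 then f (n', F n') else exist _ C0 PC0.
have F0 n : sval (F n) `<=` sval (F n.+1) by exact: (Hf (n, F n)).1.
have Fnd : {homo (fun n => sval (F n)) : n k / (n <= k)%N >-> n `<=` k}.
  move=> n k /subnK <-; elim: (k - n)%N => [|j IH]; first exact: subset_refl.
  by rewrite addSn; apply: subset_trans IH (F0 _).
have PF : P (\bigcup_n sval (F n)) by apply: PU => // n0; exact: svalP (F n0).
exists (\bigcup_n sval (F n)); split => // C' PC' sC'.
have sFC n : sval (F n) `<=` \bigcup_n sval (F n) by move=> x; exists n.
apply/eqP; rewrite eq_le measure_ge0 andbT; apply/lee_addgt0Pr => e e0.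
rewrite add0e; pose n := Num.truncn e^-1.
have ne : n.+1%:R^-1 < e by rewrite invf_plt ?posrE// truncnS_gt.
apply: le_trans (ltW _ : _ <= (n.+1%:R^-1)%:E)%E _; last by rewrite lee_fin ltW.
have sF := subset_trans (sFC n.+1) sC'.
apply: le_lt_trans ((Hf (n, F n)).2 C' PC' sF).
apply: le_measure; rewrite ?inE; last first.
  by move=> x [C'x nU]; split=> // Fx; exact/nU/(sFC n.+1).
- by apply: measurableD; apply: Pm => //; exact: svalP (F n.+1).
- by apply: measurableD; exact: Pm.
Qed.

(** * Level sets and the coarea inequality *)

Lemma measurable_setY d (X : measurableType d) (A B : set X) :
  measurable A -> measurable B -> measurable (A `+` B).
Proof. by move=> mA mB; apply: measurableU; exact: measurableD. Qed.

Lemma bigsetU_lty d (X : measurableType d) (R : realType)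
    (mu : {measure set X -> \bar R}) (I : Type) (s : seq I) (F : I -> set X) :
  (forall i, measurable (F i) /\ (mu (F i) < +oo)%E) ->
  measurable (\big[setU/set0]_(i <- s) F i) /\
  (mu (\big[setU/set0]_(i <- s) F i) < +oo)%E.
Proof.
move=> HF; apply: (big_ind (fun E => measurable E /\ (mu E < +oo)%E)) => //.
- by rewrite measure0.
- move=> E E' [mE Eoo] [mE' E'oo]; split; first exact: measurableU.
  by apply: le_lt_trans (measureU2 mu mE mE') _; exact: lte_add_pinfty.
Qed.

Lemma measurable_EFin_restr d (X : measurableType d) (R : realType) (D : set X)
    (f : X -> R) :
  measurable_fun [set: X] f -> measurable_fun D (EFin \o f).
Proof. by move=> mf; exact/measurable_EFinP/measurable_funTS. Qed.

Section level_sets.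
Context d (X : measurableType d) (R : realType).
Implicit Types f g : X -> R.

Lemma measurable_lt_set f g : measurable_fun [set: X] f ->
  measurable_fun [set: X] g -> measurable [set x | f x < g x].
Proof.
move=> mf mg; rewrite -[X in measurable X]setTI.
rewrite (_ : mkset _ = (fun x => f x < g x) @^-1` [set true]) //.
exact: (measurable_fun_ltr mf mg).
Qed.

Lemma measurable_le_set f g : measurable_fun [set: X] f ->
  measurable_fun [set: X] g -> measurable [set x | f x <= g x].
Proof.
move=> mf mg; rewrite -[X in measurable X]setTI.
rewrite (_ : mkset _ = (fun x => f x <= g x) @^-1` [set true]) //.
exact: (measurable_fun_ler mf mg).
Qed.

End level_sets.

Section layer.
Context d (X : measurableType d) (R : realType).
Variable mu : {sigma_finite_measure set X -> \bar R}.
Local Notation leb := (@lebesgue_measure R).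

Definition strip (D : set X) (a b : X -> R) : set (X * R) :=
  [set xt | D xt.1 /\ a xt.1 < xt.2 <= b xt.1].

Lemma measurable_strip D (a b : X -> R) : measurable D ->
  measurable_fun [set: X] a -> measurable_fun [set: X] b ->
  measurable (strip D a b).
Proof.
move=> mD ma mb.
have -> : strip D a b = (fst @^-1` D) `&`
    ([set xt | a xt.1 < xt.2] `&` [set xt | xt.2 <= b xt.1]).
  apply/seteqP; split => -[x t] /=; rewrite /strip/=.
    by move=> [Dx /andP].
  by move=> [Dx [-> ->]].
apply: measurableI; first by rewrite -[X in measurable X]setTI; apply: measurable_fst.
apply: measurableI.
- by apply: measurable_lt_set => //; exact: measurableT_comp.
- by apply: measurable_le_set => //; exact: measurableT_comp.
Qed.

(** Tonelli for the region between the graphs of [a] and [b].  Taking two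
    arbitrary functions, rather than 0 and [b], also measures the L^1 distance
    of two functions by the symmetric differences of their level sets. *)
Lemma layer_cake D (a b : X -> R) : measurable D ->
  measurable_fun [set: X] a -> measurable_fun [set: X] b ->
  (forall x, D x -> a x <= b x) ->
  measurable_fun [set: R] (fun t : R => mu (D `&` [set x | a x < t <= b x])) /\
  (\int[mu]_(x in D) (b x - a x)%:E =
   \int[leb]_t mu (D `&` [set x | (a x < t <= b x)%R]))%E.
Proof.
move=> mD ma mb ab; have ms := measurable_strip mD ma mb.
have secE t : ysection (strip D a b) t = D `&` [set x | a x < t <= b x].
  by apply/seteqP; split => x; rewrite ysectionE.
split.
  have := measurable_fun_ysection mu ms.
  by congr measurable_fun; apply/funext => t /=; rewrite secE.
transitivity (\int[leb]_t (mu \o ysection (strip D a b)) t)%E; last first.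
  by apply: eq_integral => t _ /=; rewrite secE.
rewrite -(indic_fubini_tonelli_GE mu ms).
have := indic_fubini_tonelli mu leb ms.
move=> <-; rewrite (indic_fubini_tonelli_FE leb ms).
rewrite integral_mkcond; apply: eq_integral => x _ /=.
rewrite patchE xsectionE; case: ifPn => [/set_mem Dx|/negP nDx].
  have -> : pair x @^-1` strip D a b = `]a x, b x]%classic.
    by apply/seteqP; split => t; rewrite /strip/= in_itv/= => //; case.
  rewrite lebesgue_measure_itv/= lte_fin.
  by case: ltgtP (ab x Dx) => // -> _; rewrite subrr.
rewrite (_ : _ @^-1` _ = set0) ?measure0//.
by apply/seteqP; split => // t [Dx _]; case: nDx; exact: mem_set.
Qed.
End layer.

(** Integrating over t an isoperimetric inequality for all superlevel sets of
    [u].  The left-hand sides add up to [e] times the integral of [u]; the symmetric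
    differences of the superlevel sets of [w i] and [u] are the slices of the
    region between the two graphs, so they add up to the L^1 distance. *)
Lemma coarea d (X : measurableType d) (R : realType)
    (mu : {sigma_finite_measure set X -> \bar R}) (I : Type) (S : seq I)
    (D : set X) (u : X -> R) (w : I -> X -> R) (e : R) :
  measurable D -> measurable_fun [set: X] u ->
  (forall i, measurable_fun [set: X] (w i)) ->
  (forall x, 0 <= u x) -> 0 <= e ->
  (forall t : R, (0 < t)%R -> e%:E * mu (D `&` [set x | (t <= u x)%R]) <=
    \sum_(i <- S) mu (D `&` ([set x | (t <= w i x)%R] `+` [set x | (t <= u x)%R])))%E ->
  (e%:E * \int[mu]_(x in D) (u x)%:E <=
    \sum_(i <- S) \int[mu]_(x in D) `|w i x - u x|%:E)%E.
Proof.
move=> mD mu_ mw u0 e0 H.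
have mcst0 : measurable_fun [set: X] (fun _ : X => 0 : R) by exact: measurable_cst.
have [m1 int1] := layer_cake mu mD mcst0 mu_ (fun x _ => u0 x).
have mmin i := measurable_minr (mw i) mu_.
have mmax i := measurable_maxr (mw i) mu_.
have ab i x : D x -> Num.min (w i x) (u x) <= Num.max (w i x) (u x).
  by move=> _; rewrite ge_min le_max lexx.
have lc i := layer_cake mu mD (mmin i) (mmax i) (ab i).
rewrite (_ : \int[mu]_(x in D) (u x)%:E = \int[mu]_(x in D) (u x - 0)%:E)%E; last first.
  by apply: eq_integral => x _; rewrite subr0.
rewrite int1 -ge0_integralZl//.
rewrite (eq_bigr (fun i => \int[mu]_(x in D)
   (Num.max (w i x) (u x) - Num.min (w i x) (u x))%:E)%E); last first.
  move=> i _; apply: eq_integral => x _; congr EFin.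
  case: (leP (w i x) (u x)) => wu; first by rewrite ler0_norm ?subr_le0// opprB.
  by rewrite gtr0_norm ?subr_gt0.
under eq_bigr => i _ do rewrite (lc i).2.
rewrite -ge0_integral_sum//; last by move=> i; exact: (lc i).1.
apply: ge0_le_integral => //.
- by move=> t _; rewrite mule_ge0 ?lee_fin.
- exact: measurable_funeM.
- by apply: emeasurable_sum => i; exact: (lc i).1.
move=> t _; have [t0|t0] := leP t 0.
  rewrite (_ : _ `&` _ = set0) ?measure0 ?mule0 ?sume_ge0//.
  by apply/seteqP; split=> // x [].
apply: le_trans (H t t0) _.
apply: lee_sum => i _; rewrite (_ : _ `+` _ =
  [set x | Num.min (w i x) (u x) < t <= Num.max (w i x) (u x)])//.
apply/seteqP; split => x /=; rewrite gt_min le_max !ltNge.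
  by case=> -[-> /negP ->]; rewrite ?orbT.
by case: (t <= w i x); case: (t <= u x) => // _; [left|right].
Qed.

(** * Limits of measures and medians *)

Lemma ex_lt_limit (R : realType) (v : nat -> \bar R) (l a : \bar R) :
  v n @[n --> \oo] --> l -> (l < a)%E -> exists n, (v n < a)%E.
Proof.
move=> vl la; apply: contrapT => /forallNP H.
have : (a <= l)%E.
  by apply: (cvge_to_ge vl); apply: nearW => n; rewrite leNgt; exact/negP.
by rewrite leNgt la.
Qed.

Lemma ex_gt_limit (R : realType) (v : nat -> \bar R) (l a : \bar R) :
  v n @[n --> \oo] --> l -> (a < l)%E -> exists n, (a < v n)%E.
Proof.
move=> vl la; apply: contrapT => /forallNP H.
have : (l <= a)%E.
  by apply: (cvge_to_le vl); apply: nearW => n; rewrite leNgt; exact/negP.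
by rewrite leNgt la.
Qed.

(** A median of [u] on [D] for [m].  Only strict inequalities on both sides are
    recorded (whence the slack [s]): this is what the superlevel sets
    [t <= max (u - c) 0] with [0 < t] require. *)
Lemma exists_median d (X : measurableType d) (R : realType)
    (m : {finite_measure set X -> \bar R}) (D : set X) (u : X -> R) :
  measurable D -> measurable_fun [set: X] u -> exists c : R, forall s, 0 < s ->
    (2%:E * m (D `&` [set x | (c + s <= u x)%R]) <= m D)%E /\
    (2%:E * m (D `&` [set x | (u x <= c - s)%R]) <= m D)%E.
Proof.
move=> mD mu_.
have mgt t : measurable (D `&` [set x | t < u x]).
  by apply: measurableI => //; exact: measurable_lt_set.
have mle t : measurable (D `&` [set x | u x <= t]).
  by apply: measurableI => //; exact: measurable_le_set.
have mge t : measurable (D `&` [set x | t <= u x]).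
  by apply: measurableI => //; exact: measurable_le_set.
have mfin (A : set X) : measurable A -> m A \is a fin_num by exact: fin_num_measure.
pose G (t : R) : R := fine (m (D `&` [set x | t < u x])).
pose M : R := fine (m D).
have GE t : m (D `&` [set x | t < u x]) = (G t)%:E by rewrite fineK// mfin.
have ME : m D = M%:E by rewrite fineK// mfin.
have Gni s t : s <= t -> G t <= G s.
  move=> st; rewrite -lee_fin -!GE; apply: le_measure; rewrite ?inE//.
  by apply: setIS => x /=; exact: le_lt_trans.
(* When [D] is null, the infimum defining [c] below is taken over all of R. *)
have [M0|M0] := eqVneq M 0.
  exists 0 => s _; rewrite ME M0.
  have z A : measurable (D `&` A) -> m (D `&` A) = 0%E.
    move=> mDA; apply/eqP; rewrite eq_le measure_ge0 andbT -[leRHS]/(0%:E) -M0 -ME.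
    by apply: le_measure; rewrite ?inE.
  by rewrite !z ?mule0.
have {}M0 : 0 < M by rewrite lt_neqAle eq_sym M0 -lee_fin -ME measure_ge0.
pose E : set R := [set t : R | 2 * G t <= M].
have E0 : E !=set0.
  have Fcv : m (D `&` [set x | n%:R < u x]) @[n --> \oo] --> 0%E.
    rewrite -(measure0 m) (_ : set0 = \bigcap_n (D `&` [set x | n%:R < u x])).
      apply: nonincreasing_cvg_mu => //.
      - by rewrite ltey_eq mfin.
      - exact: bigcap_measurable.
      - move=> n k nk; apply/subsetPset; apply: setIS => x /=.
        by apply: le_lt_trans; rewrite ler_nat.
    apply/esym/seteqP; split => // x /(_ (Num.truncn `|u x|).+1 I) [_ /=].
    rewrite ltNge => /negP; apply; apply: le_trans (ler_norm _) _.
    by rewrite ltW// truncnS_gt.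
  have M20 : (0 < (M / 2)%:E)%E by rewrite lte_fin divr_gt0.
  have [n] := ex_lt_limit Fcv M20.
  by rewrite GE lte_fin => Gn; exists n%:R => /=; move: Gn; rewrite ltr_pdivlMr// mulrC => /ltW.
have Elb : has_lbound E.
  have Fcv : m (D `&` [set x | - n%:R < u x]) @[n --> \oo] --> m D.
    have UE : D = \bigcup_n (D `&` [set x | - n%:R < u x]).
      apply/seteqP; split => [x Dx|x [n _ []]//]; exists (Num.truncn `|u x|).+1 => //.
      split => //=; rewrite ltrNl; apply: le_lt_trans (truncnS_gt _).
      by rewrite -normrN ler_norm.
    rewrite [in X in _ --> X]UE; apply: nondecreasing_cvg_mu => //.
    - by rewrite -UE.
    - move=> n k nk; apply/subsetPset; apply: setIS => x /=.
      by apply: le_lt_trans; rewrite lerN2 ler_nat.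
  have M20 : ((M / 2)%:E < m D)%E by rewrite ME lte_fin; lra.
  have [n] := ex_gt_limit Fcv M20.
  rewrite GE lte_fin => Gn; exists (- n%:R) => t /= Et.
  rewrite leNgt; apply/negP => /ltW/Gni.
  by move: Et Gn; rewrite /E/=; lra.
exists (inf E) => s s0; split.
  have [t Et tlt] := inf_adherent s0 (conj E0 Elb).
  apply: (@le_trans _ _ (2%:E * (G t)%:E)%E); last by rewrite ME lee_fin.
  rewrite -GE lee_pmul2l ?lte_fin//; apply: le_measure; rewrite ?inE//.
  by apply: setIS => x /=; exact: lt_le_trans.
have nE : ~ (2 * G (inf E - s) <= M).
  by move=> Es; have := ge_inf Elb Es; rewrite lerBrDr gerDl leNgt s0.
have : m D = (m (D `&` [set x | (u x <= inf E - s)%R]) + (G (inf E - s)%R)%:E)%E.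
  rewrite -GE -measureU//; last first.
    by apply/seteqP; split => // x [[_ /= +] [_ /=]]; rewrite ltNge => ->.
  congr (m _); rewrite -setIUr (_ : _ `|` _ = setT) ?setIT//.
  by apply/seteqP; split => // x _ /=; case: (leP (u x) (inf E - s)); [left|right].
rewrite ME -(fineK (mfin _ (mle _))) -EFinD => -[eM].
rewrite -EFinM lee_fin; move/negP: nE; rewrite -ltNge /=; lra.
Qed.

(** * Measure preserving actions *)

Section action.
Context {d : measure_display} {X : measurableType d} {R : realType} {G : groupType}.
Variables (mu : {measure set X -> \bar R}) (act : G -> X -> X).
Hypothesis act_mp : measure_preserving_action mu act.

Lemma actK g x : act g^-1%g (act g x) = x.
Proof. by have [a1 aM _ _] := act_mp; rewrite -aM mulVg a1. Qed.

Lemma actVK g x : act g (act g^-1%g x) = x.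
Proof. by have [a1 aM _ _] := act_mp; rewrite -aM mulgV a1. Qed.

Lemma image_actE g A : act g @` A = act g^-1%g @^-1` A.
Proof.
apply/seteqP; split => [_ [x Ax <-]|x Ax]; first by rewrite /= actK.
by exists (act g^-1%g x) => //; rewrite actVK.
Qed.

Lemma measurable_act g : measurable_fun [set: X] (act g).
Proof. by have [_ _ + _] := act_mp. Qed.

Lemma measurable_translate d' (Y : measurableType d') g (f : X -> Y) :
  measurable_fun [set: X] f -> measurable_fun [set: X] (fun x => f (act g x)).
Proof. by move=> mf; apply: measurableT_comp => //; exact: measurable_act. Qed.

Lemma measurable_preimage_act g A : measurable A -> measurable (act g @^-1` A).
Proof. by move=> mA; rewrite -[X in measurable X]setTI; exact: measurable_act. Qed.

Lemma measurable_image_act g A : measurable A -> measurable (act g @` A).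
Proof. by rewrite image_actE; exact: measurable_preimage_act. Qed.

Lemma measure_image_act g A : measurable A -> mu (act g @` A) = mu A.
Proof. by move=> mA; rewrite image_actE; have [_ _ _ ->] := act_mp. Qed.

Lemma ge0_integral_act g (f : X -> \bar R) :
  measurable_fun [set: X] f -> (forall x, 0 <= f x)%E ->
  (\int[mu]_x f (act g x) = \int[mu]_x f x)%E.
Proof.
move=> mf f0.
rewrite -(@ge0_integral_pushforward _ _ _ _ _ _ (measurable_act g) mu setT f)//.
apply: eq_measure_integral => [|mact A mA _]; first exact: measurable_act.
by have [_ _ _ mp] := act_mp; exact: mp.
Qed.

End action.

(** * From a Cheeger inequality to a spectral gap *)

(** Young's inequality in the factorization (a - b) * (a + b), with a free
    weight [l] so that the term in b ^+ 2 can later be absorbed. *)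
Lemma square_diff_le (R : realType) (l a b : R) : 0 < l ->
  `|a ^+ 2 - b ^+ 2| <= (1 + l^-1) * (a - b) ^+ 2 + l * b ^+ 2.
Proof.
move=> l0; have ln0 : l != 0 by rewrite gt_eqF.
have i0 : 0 <= l^-1 by rewrite invr_ge0 ltW.
rewrite ler_norml; apply/andP; split.
- rewrite lerNl -subr_ge0.
  rewrite [leRHS](_ : _ = 2 * (a - b) ^+ 2 + l^-1 * (a - b + l * b) ^+ 2).
    by apply: addr_ge0; apply: mulr_ge0 => //; exact: sqr_ge0.
  by field.
- rewrite -subr_ge0 [leRHS](_ : _ = l^-1 * (a - b - l * b) ^+ 2).
    by apply: mulr_ge0 => //; exact: sqr_ge0.
  by field.
Qed.

(** Passing to the positive and negative parts does not increase the total
    energy; the loss is the cross term, which has a sign. *)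
Lemma pos_neg_part_contract (R : realType) (a b : R) :
  (Num.max a 0 - Num.max b 0) ^+ 2 + (Num.max (- a) 0 - Num.max (- b) 0) ^+ 2
    <= (a - b) ^+ 2.
Proof.
have [a0|a0] := leP a 0; have [na0|na0] := leP (- a) 0;
  have [b0|b0] := leP b 0; have [nb0|nb0] := leP (- b) 0; nra.
Qed.

Lemma sqrt_sum_le (R : realType) (I : Type) (s : seq I) (J : I -> R) :
  (forall i, 0 <= J i) ->
  Num.sqrt (\sum_(i <- s) J i) <= \sum_(i <- s) Num.sqrt (J i).
Proof.
move=> J0; elim: s => [|i s IH]; first by rewrite !big_nil sqrtr0.
rewrite !big_cons; apply: le_trans (_ : _ <= Num.sqrt (J i) + Num.sqrt (\sum_(j <- s) J j)) _.
  have S0 : 0 <= \sum_(j <- s) J j by exact: sumr_ge0.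
  rewrite -[leRHS]ger0_norm ?addr_ge0 ?sqrtr_ge0// -sqrtr_sqr ler_wsqrtr//.
  rewrite sqrrD !sqr_sqrtr// lerD2r lerDl mulrn_wge0// mulr_ge0// sqrtr_ge0.
by rewrite lerD2l.
Qed.

Lemma sqr_normc (R : realType) (z : R[i]) :
  Normc.normc z ^+ 2 = complex.Re z ^+ 2 + complex.Im z ^+ 2.
Proof. by case: z => a b /=; rewrite sqr_sqrtr// addr_ge0 ?sqr_ge0. Qed.

Section cheeger.
Context {d : measure_display} {X : measurableType d} {R : realType} {G : groupType}.
Variables (mu : {sigma_finite_measure set X -> \bar R}) (act : G -> X -> X).
Hypothesis act_mp : measure_preserving_action mu act.
Variables (nu : {finite_measure set X -> \bar R}) (B : set X) (S : {fset G}) (e : R).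
Hypotheses (mB : measurable B) (muB : (mu B < +oo)%E) (e0 : 0 < e).
Hypothesis cheeger : forall A, measurable A ->
  (2%:E * nu (B `&` A) <= nu B)%E ->
  (e%:E * mu (B `&` A) <= \sum_(g <- S) mu (B `&` ((act g @` A) `+` A)))%E.

(* The weight in Young's inequality: summed over [S], the terms that it
   produces are at most half of the left-hand side [e * \int h ^+ 2]. *)
Let lam := e / (2 * (size S).+1%:R).
Let K := 2 / e * (1 + lam^-1).

Let lam0 : 0 < lam. Proof. by rewrite divr_gt0// mulr_gt0. Qed.

Let K0 : 0 < K.
Proof. by rewrite mulr_gt0 ?divr_gt0// addr_gt0// invr_gt0. Qed.

(** The argument of Cheeger and of Namioka: the Cheeger inequality for the
    superlevel sets of h ^+ 2 integrates to a comparison of the L^1 norm of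
    h ^+ 2 with the L^1 distances to its translates, and the latter are
    controlled by the L^2 distances of the translates of h. *)
Lemma cheeger_nonneg (h : X -> R) : measurable_fun [set: X] h ->
  (forall x, 0 <= h x) ->
  (forall t : R, 0 < t -> (2%:E * nu (B `&` [set x | (t <= h x)%R]) <= nu B)%E) ->
  (\int[mu]_(x in B) (h x ^+ 2)%:E < +oo)%E ->
  (\int[mu]_(x in B) (h x ^+ 2)%:E <=
    K%:E * \sum_(g <- S) \int[mu]_(x in B) ((h (act g^-1%g x) - h x) ^+ 2)%:E)%E.
Proof.
move=> mh h0 hnu hfin.
have mhg g : measurable_fun [set: X] (fun x => h (act g^-1%g x)).
  exact: (measurable_translate act_mp).
have mh2 : measurable_fun [set: X] (fun x => h x ^+ 2) by exact: measurable_funX.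
have mhg2 g : measurable_fun [set: X] (fun x => h (act g^-1%g x) ^+ 2).
  exact: measurable_funX.
have mdiff g : measurable_fun [set: X] (fun x => (h (act g^-1%g x) - h x) ^+ 2).
  by apply: measurable_funX; exact: measurable_funB.
have levelE (t a : R) : 0 < t -> 0 <= a -> (t <= a ^+ 2) = (Num.sqrt t <= a).
  by move=> t0 a0; rewrite -{2}(ger0_norm a0) -sqrtr_sqr ler_sqrt// sqr_ge0.
have := @coarea _ _ _ mu _ S B _ _ e mB mh2 mhg2 (fun x => sqr_ge0 _) (ltW e0).
have H (t : R) : 0 < t -> (e%:E * mu (B `&` [set x | (t <= h x ^+ 2)%R]) <=
    \sum_(g <- S) mu (B `&` ([set x | (t <= h (act g^-1%g x) ^+ 2)%R] `+`
       [set x | (t <= h x ^+ 2)%R])))%E.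
  move=> t0.
  have lE : [set x | (t <= h x ^+ 2)%R] = [set x | (Num.sqrt t <= h x)%R].
    by apply/seteqP; split=> x /=; rewrite levelE.
  rewrite lE; apply: le_trans (cheeger _ _) _.
  - by apply: measurable_le_set.
  - by apply: hnu; rewrite sqrtr_gt0.
  apply: lee_sum => g _; 
  have -> // : [set x | (t <= h (act g^-1%g x) ^+ 2)%R] =
               act g @` [set x | (Num.sqrt t <= h x)%R].
  by rewrite (image_actE act_mp); apply/seteqP; split=> x /=; rewrite levelE.
move=> /(_ H) {H} coa.
set I := (\int[mu]_(x in B) (h x ^+ 2)%:E)%E in hfin coa *.
have I0 : (0 <= I)%E by apply: integral_ge0 => x _; rewrite lee_fin sqr_ge0.
set P := (\sum_(g <- S) _)%E.
have P0 : (0 <= P)%E.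
  by apply: sume_ge0 => g _; apply: integral_ge0 => x _; rewrite lee_fin sqr_ge0.
have lami : 0 <= 1 + lam^-1 by rewrite addr_ge0// invr_ge0 ltW.
have le2 : (e%:E * I <= (1 + lam^-1)%:E * P + ((size S)%:R * lam)%:E * I)%E.
  apply: le_trans coa _.
  rewrite ge0_sume_distrr; last first.
    by move=> g _; apply: integral_ge0 => x _; rewrite lee_fin sqr_ge0.
  have -> : (((size S)%:R * lam)%:E * I = \sum_(g <- S) lam%:E * I)%E.
    have -> : (size S)%:R * lam = \sum_(g <- S) lam.
      by rewrite big_const_seq count_predT iter_addr_0 mulr_natl.
    by rewrite -sumEFin ge0_sume_distrl// => g _; rewrite lee_fin ltW.
  rewrite -big_split/=; apply: lee_sum => g _.
  rewrite -!ge0_integralZl//; last 5 first.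
  - exact: measurable_EFin_restr.
  - by move=> x _; rewrite lee_fin sqr_ge0.
  - by rewrite lee_fin ltW.
  - exact: measurable_EFin_restr.
  - by move=> x _; rewrite lee_fin sqr_ge0.
  rewrite -ge0_integralD//; last 4 first.
  - by move=> x _; rewrite -EFinM lee_fin mulr_ge0// sqr_ge0.
  - by apply: measurable_funeM; exact: measurable_EFin_restr.
  - by move=> x _; rewrite -EFinM lee_fin mulr_ge0// ?sqr_ge0// ltW.
  - by apply: measurable_funeM; exact: measurable_EFin_restr.
  apply: ge0_le_integral => //.
  - apply: measurable_EFin_restr; apply: measurableT_comp => //; exact: measurable_funB.
  - by apply: emeasurable_funD; apply: measurable_funeM; exact: measurable_EFin_restr.
  - by move=> x _; rewrite -!EFinM -EFinD lee_fin square_diff_le.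
have Ifin : I \is a fin_num by rewrite ge0_fin_numE.
have [Pfin|] := boolP (P \is a fin_num); last first.
  rewrite ge0_fin_numE// -leNgt leye_eq => /eqP ->.
  by rewrite gt0_muley ?leey// lte_fin.
move: le2; rewrite -(fineK Ifin) -(fineK Pfin) -!EFinM -EFinD !lee_fin => le2.
have nlam : (size S)%:R * lam <= e / 2.
  have -> : (size S)%:R * lam = e / 2 * ((size S)%:R / (size S).+1%:R).
    by rewrite /lam invfM; ring.
  rewrite ler_piMr//.
    by rewrite divr_ge0// ltW.
  by rewrite ler_pdivrMr// mul1r ler_nat.
have {}I0 : 0 <= fine I by exact: fine_ge0.
have := ler_wpM2r I0 nlam; set J := fine I in le2 I0 * => nl.
have {}le2 : e / 2 * J <= (1 + lam^-1) * fine P by lra.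
have -> : K * fine P = (e / 2)^-1 * ((1 + lam^-1) * fine P).
  by rewrite (invf_div e 2) mulrA.
by rewrite ler_pdivlMl ?divr_gt0.
Qed.

(** Subtracting the mean minimizes the L^2 norm among the constants, so [u] may
    be replaced by [u - c] with [c] a median, whose positive and negative parts
    both have small superlevel sets. *)
Lemma cheeger_real (u : X -> R) : measurable_fun [set: X] u ->
  (\int[mu]_(x in B) (u x ^+ 2)%:E < +oo)%E ->
  \int[mu]_(x in B) u x = 0 ->
  (\int[mu]_(x in B) (u x ^+ 2)%:E <=
    K%:E * \sum_(g <- S) \int[mu]_(x in B) ((u (act g^-1%g x) - u x) ^+ 2)%:E)%E.
Proof.
move=> mu_ ufin umean.
have intc (c : R) : mu.-integrable B (EFin \o (fun _ => c)).
  apply/integrableP; split; first exact: measurable_EFin_restr.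
  rewrite integral_cst//= lte_mul_pinfty//.
have int_u2 : mu.-integrable B (EFin \o (fun x => u x ^+ 2)).
  apply/integrableP; split; first by apply: measurable_EFin_restr; exact: measurable_funX.
  by under eq_integral => x _ do rewrite /= ger0_norm ?sqr_ge0//.
have int_u : mu.-integrable B (EFin \o u).
  apply: (@le_integrable _ _ _ _ _ mB _ (EFin \o (fun x => u x ^+ 2 + 1))).
  - exact: measurable_EFin_restr.
  - move=> x _ /=; rewrite lee_fin [leRHS]ger0_norm ?addr_ge0 ?sqr_ge0//.
    rewrite -real_normK ?num_real//; have := sqr_ge0 (`|u x| - 1); have := sqr_ge0 `|u x|; lra.
  - rewrite (_ : _ \o _ = (EFin \o (fun x => u x ^+ 2)%R) \+ (EFin \o (fun=> 1%R)))%E//.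
    exact: integrableD.
have [c Hc] := exists_median nu mB mu_.
pose v x := u x - c.
have mv : measurable_fun [set: X] v by exact: measurable_funB.
have int_cu : mu.-integrable B (fun x => (- 2 * c)%:E * (u x)%:E)%E.
  exact: integrableZl.
have int_c2 : mu.-integrable B (fun=> (c ^+ 2)%:E) by exact: intc.
have int_v2 : mu.-integrable B (EFin \o (fun x => v x ^+ 2)).
  rewrite (_ : _ \o _ = (EFin \o (fun x => u x ^+ 2)%R) \+
    ((fun x => (- 2 * c)%:E * (u x)%:E) \+ (EFin \o (fun=> c ^+ 2)%R)))%E; last first.
    by apply/funext => x /=; rewrite -!EFinM -!EFinD /v; congr EFin; ring.
  by apply: integrableD => //; exact: integrableD.
have uv : (\int[mu]_(x in B) (u x ^+ 2)%:E <= \int[mu]_(x in B) (v x ^+ 2)%:E)%E.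
  rewrite (_ : (fun x => (v x ^+ 2)%:E) = ((fun x => (u x ^+ 2)%:E) \+
    ((fun x => (- 2 * c)%:E * (u x)%:E) \+ (fun=> (c ^+ 2)%:E))))%E; last first.
    by apply/funext => x /=; rewrite -!EFinM -!EFinD /v; congr EFin; ring.
  rewrite integralD//; last exact: integrableD.
  rewrite integralD//.
  rewrite integralZl//.
  have -> : (\int[mu]_(x in B) (u x)%:E = 0)%E.
    rewrite -(@fineK _ (\int[mu]_(x in B) (u x)%:E)%E) ?umean//.
    + by rewrite [fine _]umean.
    + exact: integrable_fin_num.
  rewrite mule0 add0e leeDl// integral_ge0// => x _; rewrite lee_fin sqr_ge0//.
have vfin : (\int[mu]_(x in B) (v x ^+ 2)%:E < +oo)%E.
  have /integrableP[_] := int_v2.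
  by under eq_integral => x _ do rewrite /= ger0_norm ?sqr_ge0//.
apply: le_trans uv _.
pose p x := Num.max (v x) 0; pose q x := Num.max (- v x) 0.
have mp : measurable_fun [set: X] p by exact: measurable_maxr.
have mq : measurable_fun [set: X] q by apply: measurable_maxr => //; exact: measurable_funN.
have vpq x : v x ^+ 2 = p x ^+ 2 + q x ^+ 2.
  rewrite /p /q; case: (lerP (v x) 0) => v0.
    by rewrite expr0n/= add0r max_l ?sqrrN// oppr_ge0.
  by rewrite max_r ?oppr_le0 ?ltW// expr0n/= addr0.
have le_fin (r : X -> R) : (forall x, r x ^+ 2 <= v x ^+ 2) -> measurable_fun [set: X] r ->
    (\int[mu]_(x in B) (r x ^+ 2)%:E < +oo)%E.
  move=> rv mr; apply: le_lt_trans vfin; apply: ge0_le_integral => //.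
  - by move=> x _; rewrite lee_fin sqr_ge0.
  - by apply: measurable_EFin_restr; exact: measurable_funX.
  - by apply: measurable_EFin_restr; exact: measurable_funX.
  - by move=> x _; rewrite lee_fin.
have pfin := le_fin p (fun x => ltac:(by rewrite vpq lerDl sqr_ge0)) mp.
have qfin := le_fin q (fun x => ltac:(by rewrite vpq lerDr sqr_ge0)) mq.
have p0 x : 0 <= p x by rewrite le_max lexx orbT.
have q0 x : 0 <= q x by rewrite le_max lexx orbT.
have hp (t : R) : 0 < t -> (2%:E * nu (B `&` [set x | (t <= p x)%R]) <= nu B)%E.
  move=> t0; have := (Hc t t0).1; congr (_ * nu (_ `&` _) <= _)%E.
  apply/seteqP; split=> x /=; rewrite /p /v le_max lerBrDl.
    by move=> ->.
  by case/orP => //; rewrite leNgt t0.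
have hq (t : R) : 0 < t -> (2%:E * nu (B `&` [set x | (t <= q x)%R]) <= nu B)%E.
  move=> t0; have := (Hc t t0).2; congr (_ * nu (_ `&` _) <= _)%E.
  apply/seteqP; split=> x /=; rewrite /q /v le_max opprB lerBrDl -lerBrDr.
    by move=> ->.
  by case/orP => //; rewrite leNgt t0.
have Cp := cheeger_nonneg mp p0 hp pfin.
have Cq := cheeger_nonneg mq q0 hq qfin.
have mtr g (r : X -> R) : measurable_fun [set: X] r ->
    measurable_fun B (fun x => ((r (act g^-1%g x) - r x) ^+ 2)%:E).
  move=> mr; apply: measurable_EFin_restr; apply: measurable_funX; apply: measurable_funB => //.
  exact: (measurable_translate act_mp).
under eq_integral => x _ do rewrite vpq EFinD.
rewrite ge0_integralD//; last 4 first.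
- by move=> x _; rewrite lee_fin sqr_ge0.
- by apply: measurable_EFin_restr; exact: measurable_funX.
- by move=> x _; rewrite lee_fin sqr_ge0.
- by apply: measurable_EFin_restr; exact: measurable_funX.
apply: le_trans (leeD Cp Cq) _.
rewrite -ge0_muleDr; last 2 first.
- by apply: sume_ge0 => g _; apply: integral_ge0 => x _; rewrite lee_fin sqr_ge0.
- by apply: sume_ge0 => g _; apply: integral_ge0 => x _; rewrite lee_fin sqr_ge0.
rewrite -big_split lee_pmul2l ?lte_fin//=; apply: lee_sum => g _.
rewrite -ge0_integralD//; last 4 first.
- by move=> x _; rewrite lee_fin sqr_ge0.
- exact: mtr.
- by move=> x _; rewrite lee_fin sqr_ge0.
- exact: mtr.
apply: ge0_le_integral => //.
- by move=> x _; rewrite -EFinD lee_fin addr_ge0// sqr_ge0.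
- by apply: emeasurable_funD; exact: mtr.
- exact: mtr.
move=> x _; rewrite -EFinD lee_fin /p /q /v.
have -> : u (act g^-1%g x) - u x = (u (act g^-1%g x) - c) - (u x - c) by ring.
exact: pos_neg_part_contract.
Qed.

(** Real and imaginary parts are treated separately, and the squared norms add
    up.  Since real-valued integrals are 0 when they diverge, the finiteness of
    the local norms of the differences has to be established before the
    inequality between extended reals can be read in R. *)
Lemma cheeger_local_spectral_gap : local_spectral_gap mu act B.
Proof.
exists S, (Num.sqrt K); split; first by rewrite sqrtr_gt0.
move=> f [mRe mIm ffin] fmean.
have mtr (r : X -> R) g : measurable_fun [set: X] r ->
    measurable_fun [set: X] (fun x => r (act g x)).
  exact: (measurable_translate act_mp).
pose u x := complex.Re (f x); pose v x := complex.Im (f x).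
have normE x : Normc.normc (f x) ^+ 2 = u x ^+ 2 + v x ^+ 2 by rewrite sqr_normc.
pose du g x := u (act g^-1%g x) - u x; pose dv g x := v (act g^-1%g x) - v x.
have dnormE g x : Normc.normc (translate act g f x - f x) ^+ 2 =
    du g x ^+ 2 + dv g x ^+ 2.
  by rewrite sqr_normc/= /translate raddfB/= raddfB.
have mdu g : measurable_fun [set: X] (du g).
  by apply: measurable_funB => //; exact: mtr.
have mdv g : measurable_fun [set: X] (dv g).
  by apply: measurable_funB => //; exact: mtr.
have mf2 : measurable_fun [set: X] (fun x => Normc.normc (f x) ^+ 2).
  under eq_fun do rewrite normE.
  by apply: measurable_funD; exact: measurable_funX.
have mdf2 g : measurable_fun [set: X] (fun x => Normc.normc (translate act g f x - f x) ^+ 2).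
  under eq_fun do rewrite dnormE.
  by apply: measurable_funD; exact: measurable_funX.
have splitE (a b : X -> R) : measurable_fun [set: X] a -> measurable_fun [set: X] b ->
   (\int[mu]_(x in B) (a x ^+ 2 + b x ^+ 2)%:E =
    \int[mu]_(x in B) (a x ^+ 2)%:E + \int[mu]_(x in B) (b x ^+ 2)%:E)%E.
  move=> ma mb; under eq_integral => x _ do rewrite EFinD.
  by rewrite ge0_integralD//; [move=> x _; rewrite lee_fin sqr_ge0|
    apply: measurable_EFin_restr => //; exact: measurable_funX|
    move=> x _; rewrite lee_fin sqr_ge0|
    apply: measurable_EFin_restr => //; exact: measurable_funX].
have fB : (\int[mu]_(x in B) (Normc.normc (f x) ^+ 2)%:E < +oo)%E.
  apply: le_lt_trans ffin; apply: ge0_subset_integral => //.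
  - exact: measurable_EFin_restr.
  - by move=> x _; rewrite lee_fin sqr_ge0.
have fBg g : (\int[mu]_(x in B) (Normc.normc (f (act g^-1%g x)) ^+ 2)%:E < +oo)%E.
  apply: le_lt_trans ffin.
  rewrite -[leRHS](ge0_integral_act act_mp g^-1%g (f := fun x => (Normc.normc (f x) ^+ 2)%:E)).
  - apply: ge0_subset_integral => //.
    + apply: measurable_EFin_restr => //; exact: (mtr (fun x => Normc.normc (f x) ^+ 2)).
    + by move=> x _; rewrite lee_fin sqr_ge0.
  - exact: measurable_EFin_restr.
  - by move=> x; rewrite lee_fin sqr_ge0.
have dfin g : (\int[mu]_(x in B) (Normc.normc (translate act g f x - f x) ^+ 2)%:E < +oo)%E.
  apply: (@le_lt_trans _ _ (\int[mu]_(x in B) (2%:E * (Normc.normc (f (act g^-1%g x)) ^+ 2)%:E +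
     2%:E * (Normc.normc (f x) ^+ 2)%:E))%E).
    apply: ge0_le_integral => //.
    - by move=> x _; rewrite lee_fin sqr_ge0.
    - exact: measurable_EFin_restr.
    - apply: emeasurable_funD; apply: measurable_funeM; apply: measurable_EFin_restr => //.
      exact: (mtr (fun x => Normc.normc (f x) ^+ 2)).
    - move=> x _; rewrite -!EFinM -EFinD lee_fin dnormE !normE /du /dv.
      have := sqr_ge0 (u (act g^-1%g x) + u x).
      have := sqr_ge0 (v (act g^-1%g x) + v x); nra.
  rewrite ge0_integralD//; last 4 first.
  - by move=> x _; rewrite -EFinM lee_fin mulr_ge0// sqr_ge0.
  - apply: measurable_funeM; apply: measurable_EFin_restr => //.
    exact: (mtr (fun x => Normc.normc (f x) ^+ 2)).
  - by move=> x _; rewrite -EFinM lee_fin mulr_ge0// sqr_ge0.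
  - by apply: measurable_funeM; exact: measurable_EFin_restr.
  rewrite !ge0_integralZl//; last 4 first.
  - exact: measurable_EFin_restr.
  - by move=> x _; rewrite lee_fin sqr_ge0.
  - apply: measurable_EFin_restr => //; exact: (mtr (fun x => Normc.normc (f x) ^+ 2)).
  - by move=> x _; rewrite lee_fin sqr_ge0.
  by rewrite lte_add_pinfty// lte_mul_pinfty.
have comp_fin (a b : X -> R) : measurable_fun [set: X] a -> measurable_fun [set: X] b ->
    (forall x, b x ^+ 2 <= a x) -> (\int[mu]_(x in B) (a x)%:E < +oo)%E ->
    (\int[mu]_(x in B) (b x ^+ 2)%:E < +oo)%E.
  move=> ma mb ba; apply: le_lt_trans; apply: ge0_le_integral => //.
  - by move=> x _; rewrite lee_fin sqr_ge0.
  - by apply: measurable_EFin_restr => //; exact: measurable_funX.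
  - exact: measurable_EFin_restr.
  - by move=> x _; rewrite lee_fin.
have ufin : (\int[mu]_(x in B) (u x ^+ 2)%:E < +oo)%E.
  by apply: comp_fin fB => // x; rewrite normE lerDl sqr_ge0.
have vfin : (\int[mu]_(x in B) (v x ^+ 2)%:E < +oo)%E.
  by apply: comp_fin fB => // x; rewrite normE lerDr sqr_ge0.
move: fmean => [umean vmean].
have main : (\int[mu]_(x in B) (Normc.normc (f x) ^+ 2)%:E <= K%:E * \sum_(g <- S)
    \int[mu]_(x in B) (Normc.normc (translate act g f x - f x) ^+ 2)%:E)%E.
  under eq_integral => x _ do rewrite normE.
  rewrite splitE//.
  under eq_bigr => g _ do under eq_integral => x _ do rewrite dnormE.
  under eq_bigr => g _ do rewrite splitE//.
  rewrite big_split/= ge0_muleDr; last 2 first.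
  - by apply: sume_ge0 => g _; apply: integral_ge0 => x _; rewrite lee_fin sqr_ge0.
  - by apply: sume_ge0 => g _; apply: integral_ge0 => x _; rewrite lee_fin sqr_ge0.
  by apply: leeD; exact: cheeger_real.
have fE (r : X -> R) : (\int[mu]_(x in B) (r x ^+ 2)%:E < +oo)%E ->
    (\int[mu]_(x in B) (r x ^+ 2)%:E)%E = (\int[mu]_(x in B) (r x ^+ 2))%:E.
  move=> rfin; rewrite fineK// ge0_fin_numE// integral_ge0// => x _.
  by rewrite lee_fin sqr_ge0.
move: main; rewrite fE//.
under eq_bigr => g _ do rewrite fE//.
rewrite sumEFin -EFinM lee_fin => main.
rewrite /local_norm2.
apply: (@le_trans _ _ (Num.sqrt (K * \sum_(g <- S)
   \int[mu]_(x in B) Normc.normc (translate act g f x - f x) ^+ 2))).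
  exact: ler_wsqrtr.
rewrite sqrtrM ?(ltW K0)// ler_wpM2l ?sqrtr_ge0//.
by apply: sqrt_sum_le => g; apply: Rintegral_ge0 => x _; exact: sqr_ge0.
Qed.

End cheeger.

(** * Strong ergodicity without nets *)

Section finitary.
Context {d : measure_display} {X : measurableType d} {R : realType} {G : groupType}.
Implicit Types (nu : probability X R) (act : G -> X -> X).

Definition finitarily_strongly_ergodic nu act := forall e : R, 0 < e ->
  exists S : {fset G}, exists2 delta : R, 0 < delta & forall A, measurable A ->
    (forall g, g \in S -> nu ((act g @` A) `+` A) < delta%:E)%E ->
    (nu A * (1 - nu A) < e%:E)%E.

Lemma nbhs0_EFin (U : set (\bar R)) : nbhs 0%E U ->
  exists2 e : R, 0 < e & forall x, (0 <= x)%E -> (x < e%:E)%E -> U x.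
Proof.
move=> /nbhs_EFin /nbhs_ballP[e /= e0 eU]; exists e => // -[r||]//.
rewrite lee_fin lte_fin => r0 re; apply: eU.
by rewrite /ball/= sub0r normrN ger0_norm.
Qed.

Lemma nbhs0_lt (e : R) : 0 < e -> nbhs 0%E [set x : \bar R | (x < e%:E)%E].
Proof.
move=> e0; apply: open_nbhs_nbhs; split; last by rewrite /= lte_fin.
exact: open_ereal_lt_ereal.
Qed.

Lemma probability_split nu A : measurable A ->
  exists2 a : R, nu A = a%:E & 0 <= a <= 1.
Proof.
move=> mA; exists (fine (nu A)); first by rewrite fineK// fin_num_measure.
by rewrite -!lee_fin fineK ?fin_num_measure// measure_ge0 probability_le1.
Qed.

(** If the quantitative form fails for some e, a choice of counterexamples for
    all finite S and all delta = 1/(n+1) is a net contradicting strong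
    ergodicity.  The converse uses that a net is eventually almost invariant
    under finitely many elements at once. *)
Lemma strongly_ergodicP nu act :
  (forall g A, measurable A -> measurable (act g @` A)) ->
  strongly_ergodic nu act <-> finitarily_strongly_ergodic nu act.
Proof.
move=> mact; split=> [se e e0|fe I le A [[i0] le_refl le_trans dir] mA Hcv].
- apply: contrapT => /forallNP H.
  have /choice[A HA] : forall i : {fset G} * nat, exists A, [/\ measurable A,
      forall g, g \in i.1 -> (nu ((act g @` A) `+` A) < (i.2.+1%:R^-1)%:E)%E &
      (e%:E <= nu A * (1 - nu A))%E].
    move=> [S n] /=; have /forall2NP /(_ n.+1%:R^-1) [//|] := H S.
    move=> /existsNP[A] /not_implyP[mA] /not_implyP[AS] /negP.
    by rewrite -leNgt => eA; exists A.
  pose le (i j : {fset G} * nat) := (i.1 `<=` j.1)%fset /\ (i.2 <= j.2)%N.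
  have dle : directed_preorder le.
    split.
    + exact: (inhabits (fset0, 0%N)).
    + by move=> i; split.
    + move=> i j k [ij1 ij2] [jk1 jk2]; split; last exact: leq_trans jk2.
      exact: fsubset_trans jk1.
    + move=> i j; exists ((i.1 `|` j.1)%fset, maxn i.2 j.2); split; split => /=.
      * exact: fsubsetUl.
      * exact: leq_maxl.
      * exact: fsubsetUr.
      * exact: leq_maxr.
  have mA i : measurable (A i) by have [] := HA i.
  have := se _ le A dle mA.
  have cv g : nu ((act g @` A i) `+` A i) @[i --> net_filter le] --> 0%E.
    move=> U /nbhs0_EFin[r r0 rU].
    exists ([fset g]%fset, Num.truncn r^-1) => -[S n] [/= gS rn].
    have [_ /(_ g) + _] := HA (S, n); rewrite -fsub1set => /(_ gS) /= lt.
    apply: rU => //; apply: lt_trans lt _.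
    rewrite lte_fin invf_plt ?posrE//.
    by apply: lt_le_trans (truncnS_gt _) _; rewrite ler_nat.
  move=> /(_ cv) /(_ _ (nbhs0_lt e0))[i /(_ i (conj (fsubset_refl _) (leqnn _)))] /=.
  by have [_ _] := HA i; rewrite leNgt => /negP.
- move=> U /nbhs0_EFin[e e0 eU].
  have [S [delta delta0 Sd]] := fe e e0.
  have ev (s : seq G) : exists i, forall j, le i j -> forall g, g \in s ->
      (nu ((act g @` A j) `+` A j) < delta%:E)%E.
    elim: s => [|g s [i Hi]]; first by exists i0.
    have [k Hk] := Hcv g _ (nbhs0_lt delta0).
    have [l [il kl]] := dir i k.
    exists l => j lj h; rewrite inE => /predU1P[->|hs].
      by apply: Hk; exact: le_trans lj.
    by apply: Hi hs; exact: le_trans lj.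
  have [i Hi] := ev (enum_fset S).
  exists i => j ij; apply: eU.
    rewrite mule_ge0// subre_ge0 ?fin_num_measure//; exact: probability_le1.
  by apply: Sd => //; exact: Hi.
Qed.

End finitary.

(** * From a spectral gap to strong ergodicity *)

(** [G] may be uncountable, so the union of all translates of [B] need not be
    measurable.  A countable union [V] of translates that is maximal up to
    nu-null sets is invariant modulo null sets, hence conull by ergodicity. *)
Lemma ergodic_finite_cover {d : measure_display} {X : measurableType d} {R : realType}
    {G : groupType} (mu : {measure set X -> \bar R}) (act : G -> X -> X)
    (nu : probability X R) (B : set X) :
  measure_preserving_action mu act -> ergodic mu act ->
  nu `<< mu -> mu `<< nu -> measurable B -> (0 < mu B)%E ->
  forall e : R, 0 < e -> exists (phi : nat -> G) (N : nat),
    (nu (~` \bigcup_(n < N) (act (phi n) @` B)) < e%:E)%E.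
Proof.
move=> act_mp act_erg /null_content_dominatesP nu_mu /null_content_dominatesP mu_nu.
move=> mB muB e e0.
have mact g A : measurable A -> measurable (act g @` A).
  exact: (measurable_image_act act_mp).
pose cover (phi : nat -> G) := \bigcup_n (act (phi n) @` B).
have mcover phi : measurable (cover phi).
  by apply: bigcup_measurable => n _; exact: mact.
have Pm : range cover `<=` measurable by move=> _ [phi _ <-].
have PU (F : (set X)^nat) : (forall n, range cover (F n)) ->
    {homo F : n k / (n <= k)%N >-> n `<=` k} -> range cover (\bigcup_n F n).
  move=> PF _; have /choice[psi psiE] : forall n, exists psi, cover psi = F n.
    by move=> n; have [psi _ <-] := PF n; exists psi.
  exists (fun m => if (choice.unpickle m : option (nat * nat)) is Some nk
                   then psi nk.1 nk.2 else psi 0%N 0%N) => //.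
  apply/seteqP; split => x.
  - move=> [m _]; case: (choice.unpickle m) => [[n k]|] /= xB.
    + by exists n => //; rewrite -psiE; exists k.
    + by exists 0%N => //; rewrite -psiE; exists 0%N.
  - move=> [n _]; rewrite -psiE => -[k _ xB].
    by exists (choice.pickle (n, k)) => //; rewrite choice.pickleK.
have [_ [[phi _ <-] maxV]] := exhaustion nu Pm PU (imageP cover (I : setT (fun=> 1%g))).
set V := cover phi in maxV; have mV : measurable V := mcover phi.
have gV0 g : mu (act g @` V `\` V) = 0%E.
  apply: mu_nu; first by apply: measurableD => //; exact: mact.
  (* [psi] alternates between the translates that form [V] and those that form [g V]. *)
  pose psi m := if odd m then (g * phi m./2)%g else phi m./2.
  have VC : V `<=` cover psi.
    by move=> x [n _ xB]; exists n.*2 => //; rewrite /psi odd_double doubleK.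
  have gVC : act g @` V `<=` cover psi.
    move=> _ [_ [n _ [x Bx <-]] <-]; exists n.*2.+1 => //; exists x => //.
    by rewrite /psi /= odd_double /= uphalf_double; have [_ -> _ _] := act_mp.
  apply: (@subset_measure0 _ _ _ nu _ (cover psi `\` V)).
  - by apply: measurableD => //; exact: mact.
  - by apply: measurableD.
  - exact: setSD.
  - by apply: maxV => //; exists psi.
have Vinv g : mu ((act g @` V) `+` V) = 0%E.
  rewrite /setY measureU0//; [by apply: measurableD => //; exact: mact|
    by apply: measurableD => //; exact: mact|].
  have -> : V `\` (act g @` V) = act g @` ((act g^-1%g @` V) `\` V).
    rewrite !(image_actE act_mp) invgK; apply/seteqP; split => x /=.
      by rewrite (actVK act_mp).
    by rewrite (actVK act_mp).
  rewrite measure_image_act//.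
  by apply: measurableD => //; exact: mact.
have V0 : (0 < mu V)%E.
  apply: lt_le_trans muB _; rewrite -(measure_image_act act_mp (phi 0%N) mB).
  apply: le_measure; rewrite ?inE//; first exact: mact.
  by move=> x xB; exists 0%N.
have VC0 : nu (~` V) = 0%E.
  apply: nu_mu; first exact: measurableC.
  by have [V0'|] := act_erg V mV Vinv; first by rewrite V0' ltxx in V0.
exists phi; apply: (@ex_lt_limit _ (fun N => nu (~` \bigcup_(n < N) (act (phi n) @` B))) 0%E);
  last by rewrite lte_fin.
rewrite -VC0 (_ : ~` V = \bigcap_N ~` \bigcup_(n < N) (act (phi n) @` B)); last first.
  rewrite /V /cover -setC_bigcup; congr (~` _); apply/seteqP; split => x.
    by move=> [n _ xB]; exists n.+1 => //; exists n => /=.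
  by move=> [N _ [n _ xB]]; exists n.
have mN N : measurable (~` \bigcup_(n < N) (act (phi n) @` B)).
  by apply: measurableC; apply: bigcup_measurable => n _; exact: mact.
apply: nonincreasing_cvg_mu => //.
- by rewrite ltey_eq fin_num_measure.
- exact: bigcap_measurable.
- move=> n k nk; apply/subsetPset; apply: subsetC; apply: bigcup_subset => m /=.
  by move=> mn; exact: leq_trans nk.
Qed.

(** If [c] is the proportion of [A] in [B], then 1_A - c is at least 1/2 in
    absolute value on [A] when c <= 1/2, and off [A] otherwise; the gap applied
    to this function therefore bounds the measure of one of the two parts. *)
Lemma local_gap_dichotomy {d : measure_display} {X : measurableType d} {R : realType}
    {G : groupType} (mu : {measure set X -> \bar R}) (act : G -> X -> X) (B : set X) :
  measure_preserving_action mu act -> measurable B -> (0 < mu B)%E -> (mu B < +oo)%E ->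
  local_spectral_gap mu act B ->
  exists (S : {fset G}) (C : R), 0 <= C /\ forall A (theta : R), measurable A -> 0 <= theta ->
    (forall g, g \in S -> mu (B `&` ((act g @` A) `+` A)) <= theta%:E)%E ->
    (mu (B `&` A) <= (C * theta)%:E)%E \/ (mu (B `&` ~` A) <= (C * theta)%:E)%E.
Proof.
move=> act_mp mB B0 Boo [S [kappa [k0 gap]]].
exists S, (4 * (kappa * (size S)%:R) ^+ 2); split.
  by rewrite mulr_ge0 ?sqr_ge0.
move=> A theta mA theta0 HA.
have mact g (E : set X) : measurable E -> measurable (act g @` E).
  exact: (measurable_image_act act_mp).
(* [1_A - c] need not be square integrable; the values that the gap inequality
   involves are those on [D], which has finite measure. *)
pose D := B `|` \bigcup_(g in [set` S]) (act g^-1%g @` B).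
have [mU Uoo] : measurable (\bigcup_(g in [set` S]) (act g^-1%g @` B)) /\
    (mu (\bigcup_(g in [set` S]) (act g^-1%g @` B)) < +oo)%E.
  rewrite bigcup_fset; apply: bigsetU_lty => g; split; first exact: mact.
  by rewrite (measure_image_act act_mp).
have mD : measurable D by exact: measurableU.
have DB x : B x -> D x by left.
have DS g x : g \in S -> B x -> D (act g^-1%g x).
  by move=> gS Bx; right; exists g => //; exists x.
have Dfin : (mu D < +oo)%E.
  apply: le_lt_trans (measureU2 mu mB mU) _; exact: lte_add_pinfty.
have fB : mu B \is a fin_num by rewrite ge0_fin_numE.
have fBI (E : set X) : measurable E -> mu (B `&` E) \is a fin_num.
  move=> mE; rewrite ge0_fin_numE//; apply: le_lt_trans Boo.
  by apply: le_measure; rewrite ?inE//; exact: measurableI.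
pose b := fine (mu B); pose a := fine (mu (B `&` A)); pose c := a / b.
have b0 : 0 < b by rewrite fine_gt0// B0.
have a0 : 0 <= a by exact: fine_ge0.
have ab : a <= b.
  rewrite fine_le ?fBI//; apply: le_measure; rewrite ?inE//; exact: measurableI.
have c0 : 0 <= c by rewrite divr_ge0// ltW.
have c1 : c <= 1 by rewrite ler_pdivrMr// mul1r.
pose r x : R := (\1_A x - c) * \1_D x.
have mr : measurable_fun [set: X] r.
  by apply: measurable_funM => //; apply: measurable_funB => //; exact: measurable_indic.
have rD x : r x ^+ 2 <= \1_D x.
  rewrite /r /indic; case: (x \in D); case: (x \in A) => /=; nra.
pose f x := Complex (r x) 0.
have fE x : Normc.normc (f x) ^+ 2 = r x ^+ 2 by rewrite sqr_normc/= expr0n addr0.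
have r2fin : (\int[mu]_x (r x ^+ 2)%:E < +oo)%E.
  apply: (@le_lt_trans _ _ (\int[mu]_x (\1_D x)%:E)%E).
    apply: ge0_le_integral => //.
    - by move=> x _; rewrite lee_fin sqr_ge0.
    - by apply: measurable_EFin_restr => //; exact: measurable_funX.
    - by apply: measurable_EFin_restr => //; exact: measurable_indic.
    - by move=> x _; rewrite lee_fin.
  by rewrite integral_indic// setIT.
have fsq : square_integrable mu f.
  split => //.
  by under eq_integral => x _ do rewrite fE.
have intA : mu.-integrable B (EFin \o (\1_A : X -> R)).
  apply/integrableP; split; first by apply: measurable_EFin_restr => //; exact: measurable_indic.
  under eq_integral => x _ do rewrite /= ger0_norm//.
  by rewrite integral_indic// setIC -ge0_fin_numE// fBI.
have intc : mu.-integrable B (EFin \o (fun=> c)).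
  apply/integrableP; split; first by apply: measurable_EFin_restr => //; exact: measurable_cst.
  by rewrite integral_cst//= lte_mul_pinfty.
have indB x : B x -> \1_D x = 1 :> R.
  by move=> Bx; rewrite indicE mem_set//; exact: DB.
have fmean : complex_integral mu B f = 0.
  rewrite /complex_integral; congr Complex => /=; last by rewrite Rintegral_cst// mul0r.
  rewrite (@eq_Rintegral _ _ _ mu B (fun x => \1_A x - c)); last first.
    by move=> x /set_mem Bx; rewrite /r indB// mulr1.
  rewrite RintegralB// Rintegral_cst// /Rintegral integral_indic// setIC.
  by rewrite -/a -/b /c divfK ?subrr// gt_eqF.
have := gap f fsq fmean.
have indicB (g : G) : g \in S ->
    local_norm2 mu B (fun x => translate act g f x - f x) <= Num.sqrt theta.
  move=> gS; rewrite /local_norm2 ler_wsqrtr//.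
  rewrite (@eq_Rintegral _ _ _ mu B (\1_((act g @` A) `+` A))); last first.
    move=> x /set_mem Bx; rewrite sqr_normc/= subrr expr0n addr0.
    have -> : r (act g^-1%g x) - r x = \1_A (act g^-1%g x) - \1_A x.
      rewrite /r (indB _ Bx) (_ : \1_D (act g^-1%g x) = 1) ?mulr1; first by ring.
      by rewrite indicE mem_set//; exact: DS.
    rewrite !indicE; have [Ay|Ay] := pselect (A (act g^-1%g x)).
      have gAx : (act g @` A) x by rewrite (image_actE act_mp).
      have [Ax|Ax] := pselect (A x).
        rewrite !(mem_set Ay) (mem_set Ax) memNset ?subrr ?expr0n//.
        by case=> -[].
      rewrite !(mem_set Ay) (memNset Ax) mem_set ?subr0 ?expr1n//.
      by left.
    have gAx : ~ (act g @` A) x by rewrite (image_actE act_mp).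
    have [Ax|Ax] := pselect (A x).
      rewrite !(memNset Ay) (mem_set Ax) mem_set ?sub0r ?sqrrN ?expr1n//.
      by right.
    rewrite !(memNset Ay) (memNset Ax) memNset ?subrr ?expr0n//.
    by case=> -[].
  rewrite /Rintegral integral_indic//; last by apply: measurable_setY => //; exact: mact.
  by rewrite setIC -lee_fin fineK ?fBI ?HA//; apply: measurable_setY => //; exact: mact.
move=> gapf.
have {}gapf : local_norm2 mu B f <= kappa * ((size S)%:R * Num.sqrt theta).
  apply: le_trans gapf _; rewrite ler_wpM2l ?(ltW k0)//.
  rewrite mulr_natl -iter_addr_0 -(count_predT S) -big_const_seq big_seq [leRHS]big_seq.
  exact: ler_sum.
have r2B : (\int[mu]_(x in B) (r x ^+ 2)%:E < +oo)%E.
  apply: le_lt_trans r2fin; apply: ge0_subset_integral => //.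
  - by apply: measurable_EFin_restr => //; exact: measurable_funX.
  - by move=> x _; rewrite lee_fin sqr_ge0.
have {}gapf : (\int[mu]_(x in B) (r x ^+ 2)%:E <= ((kappa * (size S)%:R) ^+ 2 * theta)%:E)%E.
  rewrite -[leLHS]fineK; last first.
    by rewrite ge0_fin_numE// integral_ge0// => x _; rewrite lee_fin sqr_ge0.
  rewrite lee_fin -[leRHS](_ : (kappa * ((size S)%:R * Num.sqrt theta)) ^+ 2 = _); last first.
    by rewrite mulrA exprMn sqr_sqrtr.
  rewrite -ler_sqrt ?sqr_ge0// sqrtr_sqr ger0_norm; last first.
    by rewrite mulr_ge0 ?(ltW k0)// mulr_ge0// sqrtr_ge0.
  move: gapf; rewrite /local_norm2 (@eq_Rintegral _ _ _ mu B (fun x => r x ^+ 2)).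
    exact.
  by move=> x _; exact: fE.
have key (E : set X) : measurable E -> (forall x, B x -> E x -> 1 <= 4 * r x ^+ 2) ->
    (mu (B `&` E) <= (4 * (kappa * (size S)%:R) ^+ 2 * theta)%:E)%E.
  move=> mE' Er; rewrite -mulrA EFinM.
  apply: le_trans (_ : _ <= 4%:E * \int[mu]_(x in B) (r x ^+ 2)%:E)%E _; last first.
    by rewrite lee_pmul2l// lte_fin.
  rewrite -ge0_integralZl//; last 2 first.
  - by apply: measurable_EFin_restr => //; exact: measurable_funX.
  - by move=> x _; rewrite lee_fin sqr_ge0.
  rewrite setIC -integral_indic//; apply: ge0_le_integral => //.
  - by apply: measurable_EFin_restr => //; exact: measurable_indic.
  - by apply: measurable_funeM; apply: measurable_EFin_restr => //; exact: measurable_funX.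
  - move=> x Bx; rewrite -EFinM lee_fin indicE; case: (boolP (x \in E)) => [/set_mem|] xE.
      exact: Er.
    by rewrite mulr_ge0 ?sqr_ge0.
have [c2|c2] := leP c (1 / 2).
- left; apply: key => // x Bx Ax; rewrite /r indB// indicE mem_set//=; nra.
- right; apply: key; first exact: measurableC.
  move=> x Bx Ax; rewrite /r indB// indicE memNset//=; nra.
Qed.

(** The alternative of [local_gap_dichotomy] propagates from [B] to each of the
    finitely many translates that almost cover [X].  The two cases are
    exchanged by complementation. *)
Lemma local_spectral_gap_finitary {d : measure_display} {X : measurableType d}
    {R : realType} {G : groupType} (mu : {measure set X -> \bar R}) (act : G -> X -> X)
    (nu : probability X R) (B : set X) :
  measure_preserving_action mu act -> ergodic mu act -> nu `<< mu -> mu `<< nu ->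
  measurable B -> (0 < mu B)%E -> (mu B < +oo)%E ->
  local_spectral_gap mu act B -> finitarily_strongly_ergodic nu act.
Proof.
move=> act_mp act_erg nu_mu mu_nu mB B0 Boo /(local_gap_dichotomy act_mp mB B0 Boo).
move=> [S [C [C0 dich]]] e e0.
have mact g (E : set X) : measurable E -> measurable (act g @` E).
  exact: (measurable_image_act act_mp).
have e20 : 0 < e / 2 by rewrite divr_gt0.
have [phi [N coverN]] := ergodic_finite_cover act_mp act_erg nu_mu mu_nu mB B0 e20.
have [eta eta0 small_nu] := null_dominates_small nu_mu e20.
(* Each of the [N] translates costs at most [(C + 1) * theta], and the total
   must stay below [eta]. *)
pose theta := eta / ((C + 1) * N.+1%:R).
have C10 : 0 < C + 1 by rewrite ltr_wpDl.
have theta0 : 0 < theta by rewrite divr_gt0// mulr_gt0.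
have muB_nu : mfrestr mB Boo `<< nu.
  apply/null_content_dominatesP => A mA A0; rewrite /mfrestr /mrestr.
  have /null_content_dominatesP/(_ A mA A0) := mu_nu.
  by apply: subset_measure0 => //; exact: measurableI.
have [delta delta0 small_mu] := null_dominates_small muB_nu theta0.
exists (S `|` [fset (phi n)^-1%g | n in iota 0 N])%fset, delta => // A mA HA.
have mAg g (E : set X) : measurable E -> measurable ((act g @` E) `+` E).
  by move=> mE; apply: measurable_setY => //; exact: mact.
have HB g : g \in (S `|` [fset (phi n)^-1%g | n in iota 0 N])%fset ->
    (mu (B `&` ((act g @` A) `+` A)) < theta%:E)%E.
  by move=> gS; rewrite setIC; apply: (small_mu _ (mAg _ _ mA)); exact: HA.
have HS g : g \in S -> (mu (B `&` ((act g @` A) `+` A)) <= theta%:E)%E.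
  by move=> gS; apply/ltW/HB; rewrite in_fsetU gS.
have Hphi n : (n < N)%N -> (mu (B `&` ((act (phi n)^-1%g @` A) `+` A)) <= theta%:E)%E.
  move=> nN; apply/ltW/HB; rewrite in_fsetU; apply/orP; right.
  by apply/imfsetP; exists n => //=; rewrite mem_iota.
have symC g (E : set X) : (act g @` ~` E) `+` ~` E = (act g @` E) `+` E.
  rewrite !(image_actE act_mp) preimage_setC /setY !setDE !setCK setUC.
  by rewrite [X in X `|` _]setIC [X in _ `|` X]setIC.
have key (E : set X) : measurable E ->
    (forall n, (n < N)%N -> (mu (B `&` ((act (phi n)^-1%g @` E) `+` E)) <= theta%:E)%E) ->
    (mu (B `&` E) <= (C * theta)%:E)%E -> (nu E < e%:E)%E.
  move=> mE HE BE.
  pose U := \bigcup_(n < N) (act (phi n) @` B).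
  have mU : measurable U by apply: bigcup_measurable => n _; exact: mact.
  have step n : (n < N)%N -> (mu (E `&` (act (phi n) @` B)) <= ((C + 1) * theta)%:E)%E.
    move=> nN; have -> : E `&` (act (phi n) @` B) = act (phi n) @` ((act (phi n)^-1%g @` E) `&` B).
      rewrite !(image_actE act_mp) invgK; apply/seteqP; split => x /=.
        by rewrite (actVK act_mp).
      by rewrite (actVK act_mp).
    rewrite (measure_image_act act_mp); last by apply: measurableI => //; exact: mact.
    apply: (@le_trans _ _ (mu ((B `&` E) `|` (B `&` ((act (phi n)^-1%g @` E) `+` E))))).
      apply: le_measure; rewrite ?inE.
      - by apply: measurableI => //; exact: mact.
      - by apply: measurableU; apply: measurableI => //; exact: mAg.
      - move=> x [gx Bx]; have [Ex|Ex] := pselect (E x); first by left.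
        by right; split => //; left.
    apply: le_trans (measureU2 _ _ _) _; [exact: measurableI|
      by apply: measurableI => //; exact: mAg|].
    by rewrite mulrDl mul1r EFinD; apply: leeD => //; exact: HE.
  have EU : (mu (E `&` U) < eta%:E)%E.
    apply: (@le_lt_trans _ _ (\sum_(n < N) ((C + 1) * theta)%:E)%E).
      apply: le_trans (_ : _ <= \sum_(n < N) mu (E `&` (act (phi n) @` B)))%E _; last first.
        by apply: lee_sum => n _; exact: step.
      apply: (@content_subadditive _ _ _ mu (E `&` U) (fun n => E `&` (act (phi n) @` B)) N).
      - by move=> n _; apply: measurableI => //; exact: mact.
      - exact: measurableI.
      - by rewrite -(bigcup_mkord N (fun n => E `&` (act (phi n) @` B))) /U setI_bigcupr.
    rewrite (sumEFin _ _ (fun=> (C + 1) * theta)) lte_fin sumr_const card_ord -mulr_natl.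
    rewrite [ltLHS](_ : _ = eta * (N%:R / N.+1%:R)).
      by rewrite gtr_pMr// ltr_pdivrMr// mul1r ltr_nat.
    by rewrite /theta; field; rewrite (gt_eqF C10) nat1r pnatr_eq0.
  apply: (@le_lt_trans _ _ (nu (E `&` U) + nu (~` U))%E).
    apply: le_trans (measureU2 _ _ _); [|exact: measurableI|exact: measurableC].
    apply: le_measure; rewrite ?inE//.
      by apply: measurableU; [exact: measurableI|exact: measurableC].
    by move=> x Ex; have [Ux|Ux] := pselect (U x); [left|right].
  rewrite [e]splitr EFinD lteD//; apply: small_nu EU; exact: measurableI.
have nuA := probability_split nu mA; move: nuA => [a aE /andP[a0 a1]].
have [BA|BA] := dich A theta mA (ltW theta0) HS.
  have := key A mA Hphi BA; rewrite aE -EFinB -EFinM !lte_fin; nra.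
have := key (~` A) (measurableC mA).
rewrite probability_setC// aE -EFinB -EFinM !lte_fin.
move=> /(_ (fun n nN => ltac:(by rewrite symC; exact: Hphi))) /(_ BA); nra.
Qed.

(** * From strong ergodicity to a Cheeger inequality *)

Section boundary.
Context {d : measure_display} {X : measurableType d} {R : realType} {G : groupType}.
Variables (mu : {measure set X -> \bar R}) (act : G -> X -> X).
Hypothesis act_mp : measure_preserving_action mu act.
Variables (X0 : set X) (S : seq G).
Hypothesis mX0 : measurable X0.

(** The edges join g^-1 x to x for g in S.  Only those with both endpoints in
    [X0] count: otherwise the boundary of a union would involve edges leaving
    [X0], which [boundary_setU] could not control. *)
Definition boundary (C : set X) : \bar R :=
  (\sum_(g <- S) mu (X0 `&` (act g @` X0) `&` ((act g @` C) `+` C)))%E.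

Let mact g A : measurable A -> measurable (act g @` A).
Proof. exact: (measurable_image_act act_mp). Qed.

Let mdiff g A : measurable A -> measurable ((act g @` A) `+` A).
Proof. by move=> mA; apply: measurable_setY => //; exact: mact. Qed.

Let medge g A : measurable A ->
  measurable (X0 `&` (act g @` X0) `&` ((act g @` A) `+` A)).
Proof.
by move=> mA; apply: measurableI; [apply: measurableI => //; exact: mact|exact: mdiff].
Qed.

(** Write A' for the part of A in [X0] minus C.  An edge leaving the union of C
    and A' either leaves C, or joins A' to a point outside both; in the second
    case its two endpoints lie in [X0] minus C. *)
Lemma boundary_setU C A : measurable C -> measurable A ->
  (boundary (C `|` ((X0 `\` C) `&` A)) <=
   boundary C + \sum_(g <- S) mu ((X0 `\` C) `&` ((act g @` A) `+` A)))%E.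
Proof.
move=> mC mA; rewrite /boundary -big_split/=; apply: lee_sum => g _.
have mB : measurable (X0 `\` C) by exact: measurableD.
apply: le_trans (measureU2 mu _ _); [|exact: medge|by apply: measurableI => //; exact: mdiff].
apply: le_measure; rewrite ?inE.
- by apply: medge; apply: measurableU => //; exact: measurableI.
- by apply: measurableU; [exact: medge|apply: measurableI => //; exact: mdiff].
rewrite !(image_actE act_mp) => x /= [[Xx Xy] xy].
have [Cx|Cx] := pselect (C x); have [Cy|Cy] := pselect (C (act g^-1%g x)).
- by exfalso; case: xy => -[? []]; left.
- by left; split => //; right.
- by left; split => //; left.
- right; split => //.
  case: xy => -[[//|[_ Az]] nC]; [left|right]; split => //= Aw.
    by apply: nC; right.
  by apply: nC; right.
Qed.

(** The boundary is continuous along increasing unions: enlarging a set changes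
    only edges with an endpoint among the added points. *)
Lemma boundary_subset C D : measurable C -> measurable D -> C `<=` D ->
  (boundary D <= boundary C + \sum_(g <- S) (mu (D `\` C) + mu (D `\` C)))%E.
Proof.
move=> mC mD CD; rewrite /boundary -big_split/=; apply: lee_sum => g _.
have mDC : measurable (D `\` C) by exact: measurableD.
rewrite -{1}(measure_image_act act_mp g mDC).
apply: le_trans (leeD2l _ (measureU2 mu _ _)); [|exact: mact|by []].
apply: le_trans (measureU2 mu _ _); [|exact: medge|by apply: measurableU => //; exact: mact].
apply: le_measure; rewrite ?inE.
- exact: medge.
- by apply: measurableU; [exact: medge|apply: measurableU => //; exact: mact].
rewrite !(image_actE act_mp) => x /= [[Xx Xy] [[Dy Dx]|[Dx Dy]]].
- have [Cy|Cy] := pselect (C (act g^-1%g x)); last by right; left.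
  by left; split => //; left; split => //; move=> /CD.
- have [Cx|Cx] := pselect (C x); last by right; right.
  by left; split => //; right; split => //; move=> /CD.
Qed.

End boundary.

(** The complement in [X0] of a maximal set of small boundary.  The thresholds
    fit together: a set of nu-measure at most 1/4, enlarged by at most half of
    the rest, stays at or below 3/4, while nu A * (1 - nu A) < 3/16 excludes
    the interval from 1/4 to 3/4. *)
Lemma exists_cheeger_set {d : measure_display} {X : measurableType d} {R : realType}
    {G : groupType} (mu : {sigma_finite_measure set X -> \bar R}) (act : G -> X -> X)
    (nu : probability X R) :
  measure_preserving_action mu act -> nu `<< mu -> mu `<< nu ->
  finitarily_strongly_ergodic nu act ->
  exists (B : set X) (S : {fset G}) (e : R),
    [/\ measurable B, (0 < mu B)%E, (mu B < +oo)%E, 0 < e &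
    forall A, measurable A -> (2%:E * nu (B `&` A) <= nu B)%E ->
      (e%:E * mu (B `&` A) <= \sum_(g <- S) mu (B `&` ((act g @` A) `+` A)))%E].
Proof.
move=> act_mp nu_mu mu_nu fe.
have mact g (E : set X) : measurable E -> measurable (act g @` E).
  exact: (measurable_image_act act_mp).
have [S [delta delta0 HS]] := fe (3 / 16) ltac:(lra).
have [F [FT Fnd Ffin]] := (sigma_finiteP _ _).1 (sigma_finiteT mu).
have mF n : measurable (F n) by have [] := Ffin n.
(* [delta / 3] is the share of each of the two errors from outside [X0] in
   [dichotomy]; [1 / 4] keeps [nu X0] above 3/4, so that [B] is not null. *)
pose r := Num.min (delta / 3) (1 / 4).
have r0 : 0 < r by rewrite lt_min !divr_gt0.
have almost_full g : exists n, (nu (act g @` ~` F n) < r%:E)%E.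
  apply: (@ex_lt_limit _ (fun n => nu (act g @` ~` F n)) 0%E); last by rewrite lte_fin.
  rewrite -(measure0 nu) (_ : set0 = \bigcap_n (act g @` ~` F n)); last first.
    apply/esym/seteqP; split => // x gx.
    have : [set: X] (act g^-1%g x) by [].
    rewrite FT => -[n _ Fn]; have := gx n I.
    by rewrite (image_actE act_mp) /=.
  have mgF n : measurable (act g @` ~` F n) by apply: mact; exact: measurableC.
  apply: nonincreasing_cvg_mu => //.
  - by rewrite ltey_eq fin_num_measure.
  - exact: bigcap_measurable.
  - move=> n k nk; apply/subsetPset; apply: image_subset; apply: subsetC.
    exact/subsetPset/Fnd.
have [n Hn] : exists n, forall g, g \in 1%g :: enum_fset S -> (nu (act g @` ~` F n) < r%:E)%E.
  elim: (1%g :: enum_fset S) => [|g s [n Hn]]; first by exists 0%N.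
  have [k Hk] := almost_full g; exists (maxn n k) => h.
  have mono i j : (i <= j)%N -> (nu (act h @` ~` F j) <= nu (act h @` ~` F i))%E.
    move=> ij; apply: le_measure; rewrite ?inE.
    - by apply: mact; exact: measurableC.
    - by apply: mact; exact: measurableC.
    - by apply: image_subset; apply: subsetC; exact/subsetPset/Fnd.
  rewrite inE => /predU1P[hg|hs].
    by apply: le_lt_trans (mono _ _ (leq_maxr n k)) _; rewrite hg.
  by apply: le_lt_trans (mono _ _ (leq_maxl n k)) _; exact: Hn.
set X0 := F n in Hn; have mX0 : measurable X0 by exact: mF.
have X0fin : (mu X0 < +oo)%E by have [] := Ffin n.
have nuC0 : (nu (~` X0) < r%:E)%E.
  have := Hn 1%g; rewrite inE eqxx => /(_ isT).
  congr (nu _ < _)%E; rewrite (image_actE act_mp) invg1.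
  by apply/seteqP; split => x /=; have [-> _ _ _] := act_mp.
have d30 : 0 < delta / 3 by rewrite divr_gt0.
have [eta eta0 small_nu] := null_dominates_small nu_mu d30.
pose M := fine (mu X0); have ME : mu X0 = M%:E by rewrite fineK// ge0_fin_numE.
have M0 : 0 <= M by exact: fine_ge0.
pose e := eta / (M + 1); have e0 : 0 < e by rewrite divr_gt0// ltr_wpDl.
have eM : e * M < eta.
  rewrite /e mulrAC -mulrA gtr_pMr// ltr_pdivrMr ?ltr_wpDl// mul1r; lra.
pose bd := boundary mu act X0 S.
have fin_sub (E : set X) : measurable E -> E `<=` X0 -> mu E \is a fin_num.
  move=> mE EX; rewrite ge0_fin_numE//; apply: le_lt_trans X0fin.
  by apply: le_measure; rewrite ?inE.
have dichotomy C : measurable C -> C `<=` X0 -> (bd C <= e%:E * mu C)%E ->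
    (nu C < (1 / 4)%:E)%E \/ ((3 / 4)%:E < nu C)%E.
  move=> mC CX bdC.
  have : (nu C * (1 - nu C) < (3 / 16)%:E)%E.
    apply: HS => // g gS.
    pose E := X0 `&` (act g @` X0) `&` ((act g @` C) `+` C).
    have mE : measurable E.
      apply: measurableI; first by apply: measurableI => //; exact: mact.
      by apply: measurable_setY => //; exact: mact.
    have Esmall : (nu E < (delta / 3)%:E)%E.
      apply: small_nu => //; apply: (@le_lt_trans _ _ (bd C)).
        rewrite /bd /boundary (big_rem g)//= leeDl// sume_ge0//.
      apply: le_lt_trans bdC _; apply: (@le_lt_trans _ _ (e%:E * mu X0)%E).
        by rewrite lee_pmul2l ?lte_fin//; apply: le_measure; rewrite ?inE.
      by rewrite ME -EFinM lte_fin.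
    apply: (@le_lt_trans _ _ (nu (E `|` (~` X0 `|` (act g @` ~` X0))))).
      apply: le_measure; rewrite ?inE.
      - by apply: measurable_setY => //; exact: mact.
      - apply: measurableU => //; apply: measurableU; first exact: measurableC.
        by apply: mact; exact: measurableC.
      - move=> x xC; have [Xx|Xx] := pselect (X0 x); last by right; left.
        have [Xy|Xy] := pselect (X0 (act g^-1%g x)).
          by left; split => //; split => //; rewrite (image_actE act_mp).
        by right; right; rewrite (image_actE act_mp).
    apply: le_lt_trans (measureU2 nu _ _) _ => //.
      by apply: measurableU; [exact: measurableC|apply: mact; exact: measurableC].
    rewrite (_ : delta = delta / 3 + (delta / 3 + delta / 3)); last by lra.
    rewrite !EFinD; apply: lteD => //.
    apply: le_lt_trans (measureU2 nu _ _) _;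
      [exact: measurableC|by apply: mact; exact: measurableC|].
    apply: lteD.
    - by apply: lt_le_trans nuC0 _; rewrite lee_fin ge_min lexx.
    - apply: lt_le_trans (Hn g _) _; first by rewrite inE; apply/orP; right.
      by rewrite lee_fin ge_min lexx.
  have [c -> /andP[c0 c1]] := probability_split nu mC.
  rewrite -EFinB -EFinM !lte_fin => cc.
  have [c4|c4] := ltP c (1 / 4); [by left|right]; nra.
pose P C := [/\ measurable C, C `<=` X0, (bd C <= e%:E * mu C)%E & (nu C <= (1 / 4)%:E)%E].
have Pm : P `<=` measurable by move=> C [].
have P0 : P set0.
  split => //.
  - rewrite measure0 mule0 /bd /boundary big1// => g _.
    by rewrite image_set0 setYK setI0 measure0.
  - by rewrite measure0 lee_fin; lra.
have PU (C : (set X)^nat) : (forall n, P (C n)) ->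
    {homo C : n k / (n <= k)%N >-> n `<=` k} -> P (\bigcup_n C n).
  move=> PC Cnd.
  have mC k : measurable (C k) by have [] := PC k.
  have mCU : measurable (\bigcup_n C n) by exact: bigcup_measurable.
  have CX : \bigcup_n C n `<=` X0 by move=> x [k _]; have [_ + _ _] := PC k; apply.
  split => //.
  - apply/lee_addgt0Pr => t t0.
    pose t' := t / (2 * (size S).+1%:R).
    have t'0 : 0 < t' by rewrite divr_gt0// mulr_gt0.
    have mD k : measurable (\bigcup_n C n `\` C k) by exact: measurableD.
    have [k Hk] : exists k, (mu (\bigcup_n C n `\` C k) < t'%:E)%E.
      apply: (@ex_lt_limit _ (fun k => mu (\bigcup_n C n `\` C k)) 0%E); last by rewrite lte_fin.
      rewrite -(measure0 mu) (_ : set0 = \bigcap_k (\bigcup_n C n `\` C k)); last first.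
        apply/esym/seteqP; split => // x xC; have [[k _ Ck] _] := xC 0%N I.
        by have [_] := xC k I.
      apply: nonincreasing_cvg_mu => //.
      - rewrite -ge0_fin_numE//; apply: fin_sub => //.
        by apply: subset_trans CX; exact: subDsetl.
      - exact: bigcap_measurable.
      - by move=> i j ij; apply/subsetPset; apply: setDS; exact: Cnd.
    have CkU : C k `<=` \bigcup_n C n by move=> x; exists k.
    apply: le_trans (boundary_subset act_mp S mX0 (mC k) mCU CkU) _.
    apply: leeD.
      have [_ _ bdk _] := PC k; apply: le_trans bdk _.
      by rewrite lee_pmul2l ?lte_fin//; apply: le_measure; rewrite ?inE.
    apply: (@le_trans _ _ (\sum_(g <- S) (t' + t')%:E)%E).
      by apply: lee_sum => g _; rewrite EFinD; apply: leeD; exact: ltW.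
    rewrite (sumEFin _ _ (fun=> t' + t')) lee_fin big_const_seq count_predT iter_addr_0.
    rewrite -mulr_natl [leLHS](_ : _ = t * ((size S)%:R / (size S).+1%:R)); last first.
      by rewrite /t' invfM; field; rewrite nat1r pnatr_eq0.
    rewrite ger_pMr// ler_pdivrMr// mul1r ler_nat//.
  - apply: (cvge_to_le (nondecreasing_cvg_mu mC mCU _)) => //.
      by move=> i j ij; apply/subsetPset; exact: Cnd.
    by apply: nearW => k; have [] := PC k.
have [C [[mC CX bdC nuC] Cmax]] := exhaustion nu Pm PU P0.
pose B := X0 `\` C; have mB : measurable B by exact: measurableD.
have [c cE /andP[c0 c1]] := probability_split nu mC.
have [b bE /andP[b0 b1]] := probability_split nu mB.
have bc : 3 / 4 < b + c.
  have X0E : nu X0 = (nu B + nu C)%E by rewrite (measureDI nu mX0 mC) (setIidr CX).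
  move: nuC0; rewrite probability_setC// X0E bE cE.
  move=> lt_r; have {lt_r} : ((1 - (b + c))%:E < r%:E)%E by exact: lt_r.
  by rewrite lte_fin lt_min => /andP[_]; lra.
have c4 : c <= 1 / 4 by rewrite -lee_fin -cE.
exists B, S, e; split => //.
- rewrite lt_neqAle measure_ge0 andbT eq_sym; apply/eqP => B0.
  have /null_content_dominatesP/(_ B mB B0) := nu_mu.
  by rewrite bE => -[]; lra.
- by rewrite -ge0_fin_numE//; apply: fin_sub => //; exact: subDsetl.
move=> A mA half; rewrite leNgt; apply/negP => bad.
have mBA : measurable (B `&` A) by exact: measurableI.
have [a aE /andP[a0 a1]] := probability_split nu mBA.
have CBA : C `&` (B `&` A) = set0.
  by apply/seteqP; split => // x [Cx [[_ nCx] _]].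
have PC' : P (C `|` (B `&` A)).
  have mC' : measurable (C `|` (B `&` A)) by exact: measurableU.
  have C'X : C `|` (B `&` A) `<=` X0 by move=> x [/CX|[[]]].
  have bdC' : (bd (C `|` (B `&` A)) <= e%:E * mu (C `|` (B `&` A)))%E.
    rewrite measureU// ge0_muleDr//.
    by apply: le_trans (boundary_setU act_mp S mX0 mC mA) _; apply: leeD => //; exact: ltW.
  split => //.
  have := dichotomy _ mC' C'X bdC'.
  have -> : nu (C `|` (B `&` A)) = (c + a)%:E.
    by rewrite EFinD -cE -aE measureU.
  rewrite !lte_fin lee_fin => -[|]; first lra.
  by move: half; rewrite aE bE -EFinM lee_fin; lra.
have BA0 : nu (B `&` A) = 0%E.
  have := Cmax _ PC' (@subsetUl _ _ _); congr (nu _ = _).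
  apply/seteqP; split => x; first by case=> -[].
  by move=> BAx; split; [right|case: BAx => -[]].
have /null_content_dominatesP/(_ _ mBA BA0) muBA := mu_nu.
move: bad; rewrite muBA mule0 ltNge => /negP; apply.
by apply: sume_ge0.
Qed.

(** * The equivalence *)

Theorem theorem1 (R : realType) (d : measure_display) (X : measurableType d)
    (mu : {sigma_finite_measure set X -> \bar R})
    (G : groupType) (act : G -> X -> X)
    (act_mp : measure_preserving_action mu act)
    (act_erg : ergodic mu act)
    (nu : probability X R) (nu_mu : nu `<< mu) (mu_nu : mu `<< nu) :
  strongly_ergodic nu act <->
  exists B : set X, [/\ measurable B, (0 < mu B)%E, (mu B < +oo)%E &
    local_spectral_gap mu act B].
Proof.
have mact g A : measurable A -> measurable (act g @` A).
  exact: (measurable_image_act act_mp).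
split=> [/(strongly_ergodicP nu mact) fe|[B [mB B0 Boo gap]]].
- have [B [S [e [mB B0 Boo e0 cheeger]]]] := exists_cheeger_set act_mp nu_mu mu_nu fe.
  exists B; split => //.
  exact: (cheeger_local_spectral_gap act_mp mB Boo e0 cheeger).
- apply/(strongly_ergodicP nu mact).
  exact: (local_spectral_gap_finitary act_mp act_erg nu_mu mu_nu mB B0 Boo gap).
Qed.
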